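(* (In ZF, without the axiom of choice.) Assume that there is an infinite strongly amorphous set. Then there is an infinite order polynomially complete lattice.
   Context: The base theory is ZF (the axiom of choice is not used). An infinite set $A$ is called strongly amorphous if, for all natural numbers $n$, all $n$-ary relations on $A$ are first order definable (with parameters from $A$) in the language of equality. Equivalently, for every $n$, every set $R\subseteq A^n$ is in the Boolean algebra of subsets of $A^n$ generated by the sets $\{(x_1,\ldots,x_n): x_i=x_j\}$ and $\{(x_1,\ldots,x_n): x_i=a\}$ ($a\in A$). A lattice polynomial over a lattice $L$ is a lattice term in which some variables may be replaced by elements of $L$. A lattice $L$ is order polynomially complete if for every $n$ every monotone function $L^n\to L$ (with $L^n$ ordered coordinatewise) is induced by a lattice polynomial over $L$. *)

(* Defs.v *)
(** The theorem is a theorem of ZF, so it is stated for an arbitrary model of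
    first-order ZF.  Stating it for types instead would be vacuous: the choice
    axioms commonly added to Rocq refute the existence of amorphous types.
    Separation and replacement are schemas over first-order formulas (with
    second-order schemas, choice in the metatheory would pass to the model).

    All set-theoretic notions below are first-order over the model: every
    quantifier ranges over elements of [V], and natural numbers, tuples,
    relations, functions and lattice polynomials are elements of [V].  By the
    completeness theorem, truth in all models is provability in ZF. *)

Set Implicit Arguments.
Unset Strict Implicit.

Record structure : Type := Structure {
  carrier :> Type;
  mem : carrier -> carrier -> Prop
}.

Arguments mem {s} _ _.

Notation "x ∈ y" := (mem x y) (at level 70, no associativity).
Notation "x ∉ y" := (~ mem x y) (at level 70, no associativity).

(** * First-order formulas of set theory, with de Bruijn indices *)

Inductive formula : Type :=
| fMem (i j : nat)
| fEq (i j : nat)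
| fBot
| fImp (phi psi : formula)
| fAnd (phi psi : formula)
| fOr (phi psi : formula)
| fAll (phi : formula)
| fEx (phi : formula).

Definition scons (T : Type) (x : T) (e : nat -> T) (i : nat) : T :=
  match i with
  | O => x
  | S j => e j
  end.

Fixpoint sat (V : structure) (e : nat -> V) (phi : formula) : Prop :=
  match phi with
  | fMem i j => e i ∈ e j
  | fEq i j => e i = e j
  | fBot => False
  | fImp phi psi => sat e phi -> sat e psi
  | fAnd phi psi => sat e phi /\ sat e psi
  | fOr phi psi => sat e phi \/ sat e psi
  | fAll phi => forall x : V, sat (scons x e) phi
  | fEx phi => exists x : V, sat (scons x e) phi
  end.

(** * Models of ZF *)

Definition subset (V : structure) (a b : V) : Prop :=
  forall x : V, x ∈ a -> x ∈ b.

Definition is_empty (V : structure) (a : V) : Prop :=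
  forall x : V, x ∉ a.

(** [b] is the successor of [a]: b = a ∪ {a} *)
Definition is_succ (V : structure) (b a : V) : Prop :=
  forall x : V, x ∈ b <-> x ∈ a \/ x = a.

Definition inductive (V : structure) (w : V) : Prop :=
  (exists z : V, is_empty z /\ z ∈ w) /\
  (forall x : V, x ∈ w -> exists y : V, is_succ y x /\ y ∈ w).

Record ZF (V : structure) : Prop := {
  zf_extensionality :
    forall a b : V, (forall x : V, x ∈ a <-> x ∈ b) -> a = b;
  zf_foundation :
    forall a : V, (exists x : V, x ∈ a) ->
      exists x : V, x ∈ a /\ (forall y : V, y ∈ a -> y ∉ x);
  zf_pairing :
    forall a b : V, exists c : V, forall x : V, x ∈ c <-> x = a \/ x = b;
  zf_union :
    forall a : V, exists c : V, forall x : V,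
      x ∈ c <-> exists y : V, y ∈ a /\ x ∈ y;
  zf_powerset :
    forall a : V, exists c : V, forall x : V, x ∈ c <-> subset x a;
  zf_infinity :
    exists w : V, inductive w;
  (* The environment [e] supplies the parameters of [phi]. *)
  zf_separation :
    forall (phi : formula) (e : nat -> V) (a : V), exists c : V, forall x : V,
      x ∈ c <-> x ∈ a /\ sat (scons x e) phi;
  zf_replacement :
    forall (phi : formula) (e : nat -> V) (a : V),
      (forall x y z : V, x ∈ a ->
        sat (scons x (scons y e)) phi -> sat (scons x (scons z e)) phi ->
        y = z) ->
      exists c : V, forall y : V,
        y ∈ c <-> exists x : V, x ∈ a /\ sat (scons x (scons y e)) phi
}.

(** * Natural numbers, pairs, functions, tuples *)

(** Membership in the least inductive set ω *)
Definition is_nat (V : structure) (n : V) : Prop :=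
  forall w : V, inductive w -> n ∈ w.

Definition is_upair (V : structure) (p x y : V) : Prop :=
  forall z : V, z ∈ p <-> z = x \/ z = y.

(** Kuratowski pair: p = {{x}, {x, y}} *)
Definition is_opair (V : structure) (p x y : V) : Prop :=
  exists s d : V, is_upair s x x /\ is_upair d x y /\ is_upair p s d.

(** (x, y) ∈ r *)
Definition rel (V : structure) (r x y : V) : Prop :=
  exists p : V, is_opair p x y /\ p ∈ r.

(** [f] is a function from [a] to [b], as a set of ordered pairs *)
Definition is_fun (V : structure) (f a b : V) : Prop :=
  (forall p : V, p ∈ f ->
     exists x y : V, x ∈ a /\ y ∈ b /\ is_opair p x y) /\
  (forall x : V, x ∈ a -> exists! y : V, rel f x y).

Definition is_bijection (V : structure) (f a b : V) : Prop :=
  is_fun f a b /\ (forall y : V, y ∈ b -> exists! x : V, rel f x y).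

Definition infinite (V : structure) (a : V) : Prop :=
  ~ exists n f : V, is_nat n /\ is_bijection f n a.

(** x ∈ A^n: since n = {0, ..., n-1}, a tuple is a function from [n] to [A],
    and [rel x i a] says that its [i]-th entry is [a] *)
Definition is_tuple (V : structure) (A n x : V) : Prop :=
  is_fun x n A.

(** P = A^n *)
Definition is_power (V : structure) (P A n : V) : Prop :=
  forall x : V, x ∈ P <-> is_tuple A n x.

(** * Strongly amorphous sets *)

Definition is_relation (V : structure) (A n R : V) : Prop :=
  forall x : V, x ∈ R -> is_tuple A n x.

(** [B] is a Boolean algebra of subsets of A^n *)
Definition boolean_algebra (V : structure) (A n B : V) : Prop :=
  (forall R : V, R ∈ B -> is_relation A n R) /\
  (forall P : V, is_power P A n -> P ∈ B) /\
  (forall R S : V, R ∈ B ->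
     (forall x : V, x ∈ S <-> is_tuple A n x /\ x ∉ R) -> S ∈ B) /\
  (forall R S U : V, R ∈ B -> S ∈ B ->
     (forall x : V, x ∈ U <-> x ∈ R \/ x ∈ S) -> U ∈ B).

(** [B] contains the sets {x ∈ A^n : x_i = x_j} and {x ∈ A^n : x_i = a} *)
Definition contains_equalities (V : structure) (A n B : V) : Prop :=
  (forall i j D : V, i ∈ n -> j ∈ n ->
     (forall x : V, x ∈ D <->
        is_tuple A n x /\ exists a : V, rel x i a /\ rel x j a) ->
     D ∈ B) /\
  (forall i a D : V, i ∈ n -> a ∈ A ->
     (forall x : V, x ∈ D <-> is_tuple A n x /\ rel x i a) ->
     D ∈ B).

Definition in_generated_algebra (V : structure) (A n R : V) : Prop :=
  forall B : V, boolean_algebra A n B -> contains_equalities A n B -> R ∈ B.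

(** First-order definability with parameters in the language of equality, in
    its quantifier-free form *)
Definition strongly_amorphous (V : structure) (A : V) : Prop :=
  forall n R : V, is_nat n -> is_relation A n R -> in_generated_algebra A n R.

(** * Lattices *)

Definition is_partial_order (V : structure) (L r : V) : Prop :=
  (forall p : V, p ∈ r ->
     exists x y : V, x ∈ L /\ y ∈ L /\ is_opair p x y) /\
  (forall x : V, x ∈ L -> rel r x x) /\
  (forall x y : V, rel r x y -> rel r y x -> x = y) /\
  (forall x y z : V, rel r x y -> rel r y z -> rel r x z).

Definition is_join (V : structure) (L r x y z : V) : Prop :=
  z ∈ L /\ rel r x z /\ rel r y z /\
  (forall u : V, u ∈ L -> rel r x u -> rel r y u -> rel r z u).

Definition is_meet (V : structure) (L r x y z : V) : Prop :=
  z ∈ L /\ rel r z x /\ rel r z y /\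
  (forall u : V, u ∈ L -> rel r u x -> rel r u y -> rel r u z).

Definition is_lattice (V : structure) (L r : V) : Prop :=
  is_partial_order L r /\
  (forall x y : V, x ∈ L -> y ∈ L ->
     (exists z : V, is_join L r x y z) /\ (exists z : V, is_meet L r x y z)).

(** * Lattice polynomials

    Polynomials are coded by the sets (0, i) (the variable x_i), (1, a) (the
    element a of L), (2, (s, t)) (the term s ∨ t) and (3, (s, t)) (the term
    s ∧ t). *)

Fixpoint is_numeral (V : structure) (k : nat) (c : V) : Prop :=
  match k with
  | O => is_empty c
  | S k => exists d : V, is_numeral k d /\ is_succ c d
  end.

Definition is_tagged (V : structure) (k : nat) (t x : V) : Prop :=
  exists c : V, is_numeral k c /\ is_opair t c x.

Definition var_term (V : structure) (t i : V) : Prop :=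
  is_tagged 0 t i.

Definition const_term (V : structure) (t a : V) : Prop :=
  is_tagged 1 t a.

Definition join_term (V : structure) (t s u : V) : Prop :=
  exists q : V, is_opair q s u /\ is_tagged 2 t q.

Definition meet_term (V : structure) (t s u : V) : Prop :=
  exists q : V, is_opair q s u /\ is_tagged 3 t q.

Definition closed_under_terms (V : structure) (L n T : V) : Prop :=
  (forall i t : V, i ∈ n -> var_term t i -> t ∈ T) /\
  (forall a t : V, a ∈ L -> const_term t a -> t ∈ T) /\
  (forall s u t : V, s ∈ T -> u ∈ T -> join_term t s u -> t ∈ T) /\
  (forall s u t : V, s ∈ T -> u ∈ T -> meet_term t s u -> t ∈ T).

(** The lattice polynomials over [L] in the variables x_0, ..., x_{n-1} form
    the least set closed under term formation; ZF proves that it exists. *)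
Definition is_polynomial (V : structure) (L n p : V) : Prop :=
  forall T : V, closed_under_terms L n T -> p ∈ T.

Definition closed_under_evaluation (V : structure) (L r n x W : V) : Prop :=
  (forall i t a : V, i ∈ n -> var_term t i -> rel x i a -> rel W t a) /\
  (forall a t : V, a ∈ L -> const_term t a -> rel W t a) /\
  (forall s u t a b c : V, rel W s a -> rel W u b ->
     join_term t s u -> is_join L r a b c -> rel W t c) /\
  (forall s u t a b c : V, rel W s a -> rel W u b ->
     meet_term t s u -> is_meet L r a b c -> rel W t c).

(** The polynomial [p] takes the value [y] at the tuple [x] ∈ L^n.  The graph
    of evaluation at [x] is the least relation closed under the evaluation
    rules; since terms are uniquely readable, ZF proves that it is a function
    from the set of polynomials to [L]. *)
Definition has_value (V : structure) (L r n x p y : V) : Prop :=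
  forall W : V, closed_under_evaluation L r n x W -> rel W p y.

(** [f] : L^n → L is the function induced by [p]: for every x ∈ L^n, the value
    of [p] at [x] is f(x) *)
Definition induces (V : structure) (L r n p f : V) : Prop :=
  forall x y : V, is_tuple L n x -> rel f x y -> has_value L r n x p y.

(** * Order polynomial completeness *)

Definition tuple_le (V : structure) (r n x y : V) : Prop :=
  forall i a b : V, i ∈ n -> rel x i a -> rel y i b -> rel r a b.

Definition is_monotone (V : structure) (L r n f : V) : Prop :=
  forall x x' y y' : V, is_tuple L n x -> is_tuple L n x' ->
    tuple_le r n x x' -> rel f x y -> rel f x' y' -> rel r y y'.

Definition order_polynomially_complete (V : structure) (L r : V) : Prop :=
  forall n P f : V, is_nat n -> is_power P L n -> is_fun f P L ->
    is_monotone L r n f ->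
    exists p : V, is_polynomial L n p /\ induces L r n p f.

(* Main.v *)
Require Import Defs.
From Stdlib Require Import Classical ClassicalEpsilon PeanoNat.

Set Implicit Arguments.
Unset Strict Implicit.

(** The strongly amorphous set [A] itself carries the lattice: two of its
    elements are made the bottom [o] and the top [l], and all others are
    pairwise incomparable atoms between them.  A monotone f : A^n → A is a
    relation of arity n + 1 on [A], so it is definable from equality and
    finitely many parameters.  What is used of this is a finite S ⊆ A such that
    [f] commutes with every transposition of two elements outside [S]
    ([strongly_amorphous_equivariant]); the relations with such an [S] form a
    Boolean algebra that contains the generators.  As [A] is infinite, it
    follows that f(x) is an element of [S] or an entry of [x]
    ([equivariant_value]).

    Call two tuples of the same type if they satisfy the same equalities among
    their entries, the elements of [S] and the value of [f].  There are finitely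
    many types, so it is enough to find for each [c] a polynomial [q] ≤ [f] that
    is at least [f] on the type of [c], and to take the join of these
    ([approximable_split]).  The polynomial [q] is the meet of a value part (the
    constant f(c), or all x_j with c_j = f(c)) with finitely many polynomials
    that only take the values [o] and [l] and that test whether [x] lies above
    some tuple of the type of [c].  Such tests exist since there are at least
    three atoms ([attainable_above]).  The heart of the proof is [le_value]: if
    [x] passes the tests, then transpositions move [c] to a tuple c' ≤ x of the
    same type ([exists_below]), and monotonicity gives f(c') ≤ f(x).

    All of this takes place inside a model of ZF, whose natural numbers may be
    nonstandard.  Finite families are therefore handled by internal inductions,
    and every predicate used in separation, replacement or induction must be
    given by a first-order formula; the tactic [definability] finds it. *)

(** * Predicates definable by first-order formulas *)

Section Definability.
Variable V : structure.
Notation env := (nat -> V).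

Definition lookup (t : nat + V) (e : env) : V :=
  match t with inl i => e i | inr a => a end.

(** The free variables of the formula are interpreted by terms: [inl i] refers
    to the i-th variable of the environment, and [inr a] is the parameter [a].
    Parameters thus take no space in the environment, so that it changes in the
    same way under all quantifiers. *)
Definition definable (P : env -> Prop) : Prop :=
  exists phi s, forall e, P e <-> sat (fun i => lookup (s i) e) phi.

(** A term is definable if its graph is; variable 0 is the value, and the
    arguments are the variables after it. *)
Definition definable_term (t : env -> V) : Prop :=
  definable (fun e => e 0 = t (fun i => e (S i))).

Fixpoint rename (rho : nat -> nat) (phi : formula) : formula :=
  match phi with
  | fMem i j => fMem (rho i) (rho j)
  | fEq i j => fEq (rho i) (rho j)
  | fBot => fBot
  | fImp phi psi => fImp (rename rho phi) (rename rho psi)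
  | fAnd phi psi => fAnd (rename rho phi) (rename rho psi)
  | fOr phi psi => fOr (rename rho phi) (rename rho psi)
  | fAll phi => fAll (rename (scons 0 (fun i => S (rho i))) phi)
  | fEx phi => fEx (rename (scons 0 (fun i => S (rho i))) phi)
  end.

Lemma sat_rename phi : forall rho (e e' : env),
  (forall i, e' i = e (rho i)) -> sat e (rename rho phi) <-> sat e' phi.
Proof.
  induction phi; intros rho e e' H; simpl; rewrite ?H; try tauto;
    try (rewrite (IHphi1 rho e e' H), (IHphi2 rho e e' H); tauto).
  - assert (K : forall x, sat (scons x e) (rename (scons 0 (fun i => S (rho i))) phi)
      <-> sat (scons x e') phi) by (intro x; apply IHphi; intros [|i]; simpl; auto).
    split; intros H1 x; apply K, H1.
  - assert (K : forall x, sat (scons x e) (rename (scons 0 (fun i => S (rho i))) phi)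
      <-> sat (scons x e') phi) by (intro x; apply IHphi; intros [|i]; simpl; auto).
    split; intros [x H1]; exists x; apply K, H1.
Qed.

Lemma definable_iff P Q :
  (forall e, P e <-> Q e) -> definable P -> definable Q.
Proof. intros H (phi & s & K). exists phi, s. intro e. rewrite <- H. apply K. Qed.

(** To combine two formulas, their variables are sent to the even and to the odd
    indices, and the interpretations are interleaved. *)
Lemma definable_two (op : formula -> formula -> formula) (o : Prop -> Prop -> Prop) P Q :
  (forall e phi psi, sat (V:=V) e (op phi psi) <-> o (sat e phi) (sat e psi)) ->
  (forall A A' B B' : Prop, (A <-> A') -> (B <-> B') -> o A B <-> o A' B') ->
  definable P -> definable Q -> definable (fun e => o (P e) (Q e)).
Proof.
  intros Hop Ho (phi & s & Hs) (psi & t & Ht).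
  exists (op (rename (fun i => 2 * i) phi) (rename (fun i => S (2 * i)) psi)).
  exists (fun i => if Nat.even i then s (Nat.div2 i) else t (Nat.div2 i)).
  intro e. rewrite Hop. apply Ho.
  - rewrite Hs. symmetry. apply sat_rename. intro i.
    rewrite Nat.even_mul. cbn [Nat.even orb]. now rewrite Nat.div2_double.
  - rewrite Ht. symmetry. apply sat_rename. intro i.
    rewrite Nat.even_succ, Nat.odd_mul. cbn [Nat.odd Nat.even negb andb].
    now rewrite Nat.div2_succ_double.
Qed.

Lemma definable_and P Q :
  definable P -> definable Q -> definable (fun e => P e /\ Q e).
Proof. apply (@definable_two fAnd); simpl; tauto. Qed.

Lemma definable_or P Q :
  definable P -> definable Q -> definable (fun e => P e \/ Q e).
Proof. apply (@definable_two fOr); simpl; tauto. Qed.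

Lemma definable_imp P Q :
  definable P -> definable Q -> definable (fun e => P e -> Q e).
Proof. apply (@definable_two fImp (fun A B => A -> B)); simpl; tauto. Qed.

(** By cases on [A]: no formula has to express what [A] says. *)
Lemma definable_const (A : Prop) : definable (fun _ => A).
Proof.
  destruct (classic A); [exists (fImp fBot fBot), inl|exists fBot, inl]; simpl; tauto.
Qed.

Lemma definable_not P : definable P -> definable (fun e => ~ P e).
Proof. intro H. apply definable_imp; auto using definable_const. Qed.

Lemma definable_equiv P Q :
  definable P -> definable Q -> definable (fun e => P e <-> Q e).
Proof. intros. apply definable_and; apply definable_imp; auto. Qed.

(** A formula may refer to the bound variable through several of its free
    variables (all those interpreted by [inl 0]); before quantification they are
    identified, as index 0. *)
Lemma definable_quant (s : nat -> nat + V) : exists rho s', forall x (e : env) i,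
  lookup (s i) (scons x e) = scons x (fun j => lookup (s' j) e) (rho i).
Proof.
  exists (fun i => match s i with inl 0 => 0 | _ => S i end).
  exists (fun i => match s i with inl (S k) => inl k | t => t end).
  intros x e i. destruct (s i) as [[|k]|a] eqn:E; simpl; rewrite ?E; reflexivity.
Qed.

Lemma definable_all (P : V -> env -> Prop) :
  definable (fun e => P (e 0) (fun i => e (S i))) ->
  definable (fun e => forall x, P x e).
Proof.
  intros (phi & s & H). destruct (definable_quant s) as (rho & s' & K).
  exists (fAll (rename rho phi)), s'. intro e. simpl.
  split; intros G x; specialize (G x); specialize (H (scons x e)); simpl in H.
  - apply (sat_rename phi (e' := fun i => lookup (s i) (scons x e))); [intro; apply K|].
    apply H, G.
  - apply H. apply (sat_rename phi (rho := rho) (e := scons x (fun j => lookup (s' j) e)));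
      [intro; apply K|assumption].
Qed.

Lemma definable_ex (P : V -> env -> Prop) :
  definable (fun e => P (e 0) (fun i => e (S i))) ->
  definable (fun e => exists x, P x e).
Proof.
  intros H. apply definable_iff with (fun e => ~ forall x, ~ P x e).
  - intro e. split; [intro; now apply not_all_not_ex|intros [x G] K; exact (K x G)].
  - apply definable_not, definable_all, definable_not, H.
Qed.

Lemma definable_rename P (rho : nat -> nat) :
  definable P -> definable (fun e => P (fun i => e (rho i))).
Proof.
  intros (phi & s & H).
  exists phi, (fun i => match s i with inl k => inl (rho k) | t => t end).
  intro e. rewrite H. rewrite <- (sat_rename phi (rho := fun i => i)
    (e := fun i => lookup (s i) (fun i => e (rho i)))); [|reflexivity].
  rewrite (sat_rename phi (rho := fun i => i)
    (e' := fun i => lookup match s i with inl k => inl (rho k) | t => t end e)); [tauto|].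
  intro i. destruct (s i); reflexivity.
Qed.

Lemma definable_term_var k : definable_term (fun e => e k).
Proof. exists (fEq 0 1), (scons (inl 0) (fun _ => inl (S k))). simpl. tauto. Qed.

Lemma definable_term_const a : definable_term (fun _ => a).
Proof. exists (fEq 0 1), (scons (inl 0) (fun _ => inr a)). simpl. tauto. Qed.

(** A definable term is eliminated by P(t) ↔ ∃ x, x = t ∧ P(x). *)
Lemma definable_subst (P : V -> env -> Prop) t :
  definable (fun e => P (e 0) (fun i => e (S i))) -> definable_term t ->
  definable (fun e => P (t e) e).
Proof.
  intros HP Ht. apply definable_iff with (fun e => exists x, x = t e /\ P x e).
  - intro e. split; [intros (x & -> & H); exact H|intro H; exists (t e); auto].
  - apply definable_ex. apply definable_and; assumption.
Qed.

Lemma definable_term_weaken t :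
  definable_term t -> definable_term (fun e => t (fun i => e (S i))).
Proof. exact (@definable_rename _ (scons 0 (fun i => S (S i)))). Qed.

(** Definability of a predicate in its own arguments.  Being classes, these
    resolve each atomic predicate that [definability] meets. *)
Class definable1 (P : V -> Prop) : Prop :=
  def1 : definable (fun e => P (e 0)).
Class definable2 (P : V -> V -> Prop) : Prop :=
  def2 : definable (fun e => P (e 0) (e 1)).
Class definable3 (P : V -> V -> V -> Prop) : Prop :=
  def3 : definable (fun e => P (e 0) (e 1) (e 2)).
Lemma definable_app1 P a :
  definable1 P -> definable_term a -> definable (fun e => P (a e)).
Proof. intros H Ha. exact (definable_subst (P := fun x _ => P x) H Ha). Qed.

Lemma definable_app2 P a b :
  definable2 P -> definable_term a -> definable_term b ->
  definable (fun e => P (a e) (b e)).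
Proof.
  intros H Ha Hb.
  apply (definable_subst (P := fun x e => P x (b e)) (t := a)); [|assumption].
  apply (definable_subst (P := fun y e => P (e 0) y) (t := fun e => b (fun i => e (S i)))).
  - exact (definable_rename (scons 1 (scons 0 S)) H).
  - now apply definable_term_weaken.
Qed.

Lemma definable_app3 P a b c :
  definable3 P -> definable_term a -> definable_term b -> definable_term c ->
  definable (fun e => P (a e) (b e) (c e)).
Proof.
  intros H Ha Hb Hc.
  apply (definable_subst (P := fun x e => P x (b e) (c e)) (t := a)); [|assumption].
  apply (definable_subst (P := fun y e => P (e 0) y (c (fun i => e (S i))))
    (t := fun e => b (fun i => e (S i)))); [|now apply definable_term_weaken].
  apply (definable_subst (P := fun z e => P (e 1) (e 0) z)
    (t := fun e => c (fun i => e (S (S i)))));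
    [|now apply definable_term_weaken, definable_term_weaken in Hc].
  exact (definable_rename (scons 2 (scons 1 (scons 0 S))) H).
Qed.

Class definable_fun1 (f : V -> V) : Prop :=
  defun1 : definable_term (fun e => f (e 0)).
Class definable_fun2 (f : V -> V -> V) : Prop :=
  defun2 : definable_term (fun e => f (e 0) (e 1)).

Lemma definable_term_app1 f a :
  definable_fun1 f -> definable_term a -> definable_term (fun e => f (a e)).
Proof.
  intros H Ha. apply (definable_app2 (P := fun y x => y = f x) (a := fun e => e 0)).
  - exact H.
  - apply definable_term_var.
  - now apply definable_term_weaken.
Qed.

Lemma definable_term_app2 f a b :
  definable_fun2 f -> definable_term a -> definable_term b ->
  definable_term (fun e => f (a e) (b e)).
Proof.
  intros H Ha Hb. apply (definable_app3 (P := fun z x y => z = f x y) (a := fun e => e 0)).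
  - exact H.
  - apply definable_term_var.
  - now apply definable_term_weaken.
  - now apply (definable_term_weaken Hb).
Qed.

#[global] Instance definable_mem : definable2 (@mem V).
Proof. exists (fMem 0 1), inl. simpl. tauto. Qed.

#[global] Instance definable_eq : definable2 (@eq V).
Proof. exists (fEq 0 1), inl. simpl. tauto. Qed.

End Definability.

(** Extended below, once terms with bound variables exist. *)
Ltac definability_of_term := fail.

(** Follows the syntax of a predicate of environments down to its atoms; each
    binder is replaced by variable 0 of the environment. *)
Ltac definability :=
  cbv beta;
  first
  [ assumption
  | simple apply definable_term_var
  | simple apply definable_term_const
  | simple apply definable_const
  | simple apply definable_and; definability
  | simple apply definable_or; definability
  | simple apply definable_equiv; definability
  | simple apply definable_not; definability
  | simple apply definable_all; definability
  | simple apply definable_ex; definability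
  | simple apply definable_imp; definability
  | definability_of_term; definability
  | simple apply definable_app3; [typeclasses eauto| definability..]
  | simple apply definable_app2; [typeclasses eauto| definability..]
  | simple apply definable_app1; [typeclasses eauto| definability..]
  | simple apply definable_term_app2; [typeclasses eauto| definability..]
  | simple apply definable_term_app1; [typeclasses eauto| definability..]
  | idtac ].

(** * Separation, replacement and definite descriptions *)

Existing Class ZF.

Ltac unfold_definable :=
  unfold definable1, definable2, definable3, definable_fun1, definable_fun2.

Section Descriptions.
Context {V : structure} {HV : ZF V}.
Implicit Types (a b c f x y z n : V).

#[global] Instance definable_subset : definable2 (@subset V).
Proof. unfold_definable; unfold subset. definability. Qed.
#[global] Instance definable_is_empty : definable1 (@is_empty V).
Proof. unfold_definable; unfold is_empty. definability. Qed.
#[global] Instance definable_is_succ : definable2 (@is_succ V).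
Proof. unfold_definable; unfold is_succ. definability. Qed.
#[global] Instance definable_is_nat : definable1 (@is_nat V).
Proof. unfold_definable; unfold is_nat, inductive. definability. Qed.
#[global] Instance definable_is_opair : definable3 (@is_opair V).
Proof. unfold_definable; unfold is_opair, is_upair. definability. Qed.
#[global] Instance definable_rel : definable3 (@rel V).
Proof. unfold_definable; unfold rel. definability. Qed.
#[global] Instance definable_is_fun : definable3 (@is_fun V).
Proof. unfold_definable; unfold is_fun, unique. definability. Qed.
#[global] Instance definable_is_bijection : definable3 (@is_bijection V).
Proof. unfold_definable; unfold is_bijection, unique. definability. Qed.
#[global] Instance definable_is_tuple : definable3 (@is_tuple V).
Proof. unfold_definable; unfold is_tuple. definability. Qed.

Lemma ext a b : (forall x, x ∈ a <-> x ∈ b) -> a = b.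
Proof. apply zf_extensionality, HV. Qed.

(** Separation admits formulas whose variable 0 ranges over the set and whose
    other variables are parameters.  Formula variables that refer to no argument
    of [P] receive the dummy value [v]. *)
Lemma definable1_formula (P : V -> Prop) (v : V) : definable1 P ->
  exists phi e, forall x, P x <-> sat (scons x e) phi.
Proof.
  intros (phi & s & H).
  exists (rename (fun i => match s i with inl 0 => 0 | _ => S i end) phi).
  exists (fun i => lookup (s i) (fun _ => v)).
  intro x. specialize (H (scons x (fun _ => v))). simpl in H. rewrite H.
  symmetry. apply sat_rename. intro i. destruct (s i) as [[|k]|b] eqn:E; simpl; rewrite ?E; auto.
Qed.

Lemma definable2_formula (P : V -> V -> Prop) (v : V) : definable2 P ->
  exists phi e, forall x y, P x y <-> sat (scons x (scons y e)) phi.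
Proof.
  intros (phi & s & H).
  exists (rename (fun i => match s i with inl 0 => 0 | inl 1 => 1 | _ => S (S i) end) phi).
  exists (fun i => lookup (s i) (fun _ => v)).
  intros x y. specialize (H (scons x (scons y (fun _ => v)))). simpl in H. rewrite H.
  symmetry. apply sat_rename. intro i.
  destruct (s i) as [[|[|k]]|b] eqn:E; simpl; rewrite ?E; auto.
Qed.

Definition is_set (P : V -> Prop) : Prop := exists c, forall x, x ∈ c <-> P x.

Lemma is_set_sep a P : definable1 P -> is_set (fun x => x ∈ a /\ P x).
Proof.
  intro H. destruct (definable1_formula a H) as (phi & e & K).
  destruct (zf_separation HV phi e a) as [c Hc]. exists c. intro x. rewrite Hc, K. tauto.
Qed.

Lemma is_set_subclass a P :
  definable1 P -> (forall x, P x -> x ∈ a) -> is_set P.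
Proof.
  intros H K. destruct (is_set_sep a H) as [c Hc]. exists c. intro x. rewrite Hc.
  split; [tauto|auto].
Qed.

Lemma is_set_image a F : definable_fun1 F -> is_set (fun y => exists x, x ∈ a /\ y = F x).
Proof.
  intro H.
  assert (K : definable2 (fun x y => y = F x)) by (unfold_definable; definability).
  destruct (definable2_formula a K) as (phi & e & G).
  destruct (zf_replacement HV (phi := phi) (e := e) (a := a)) as [c Hc].
  - intros x y z _ H1 H2. apply G in H1, H2. congruence.
  - exists c. intro y. rewrite Hc. split; intros (x & H1 & H2); exists x; split; auto;
      apply G; auto.
Qed.

Lemma is_set_union a : is_set (fun x => exists y, y ∈ a /\ x ∈ y).
Proof. apply (zf_union HV). Qed.

Lemma exists_empty : exists z, is_empty z.
Proof.
  destruct (zf_infinity HV) as [w [[z [H _]] _]]. exists z; exact H.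
Qed.

Lemma model_inhabited : inhabited V.
Proof. destruct exists_empty as [z _]. exact (inhabits z). Qed.

Definition describes (P : V -> Prop) y : Prop :=
  unique P y \/ (~ exists z, unique P z) /\ is_empty y.

(** Set-theoretic operations are defined through this operator.  It is total and
    its graph is first-order without side conditions, so every term built with
    it can occur in definable predicates ([definable_the]), even outside its
    intended domain. *)
Definition the (P : V -> Prop) : V := epsilon model_inhabited (describes P).

Lemma describes_unique P y z : describes P y -> describes P z -> y = z.
Proof.
  intros [H|[H1 H2]] [K|[K1 K2]].
  - apply H, K.
  - exfalso; eauto.
  - exfalso; eauto.
  - apply ext. intro x. split; intro G; exfalso; [exact (H2 x G)|exact (K2 x G)].
Qed.

Lemma the_describes P : describes P (the P).
Proof.
  apply (epsilon_spec model_inhabited (describes P)).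
  destruct (classic (exists z, unique P z)) as [[z H]|H].
  - exists z. now left.
  - destruct exists_empty as [z K]. exists z. now right.
Qed.

Lemma the_eq P y : P y -> (forall z, P z -> z = y) -> the P = y.
Proof.
  intros H K. apply (describes_unique (the_describes P)). left. split; auto.
  intros z Hz. symmetry; auto.
Qed.

Lemma definable_the (P : (nat -> V) -> V -> Prop) :
  definable (fun e => P (fun i => e (S i)) (e 0)) ->
  definable_term (fun e => the (P e)).
Proof.
  intro H. unfold definable_term.
  apply definable_iff with (fun e => describes (P (fun i => e (S i))) (e 0)).
  - intro e. split.
    + intro K. exact (describes_unique K (the_describes _)).
    + intros ->. apply the_describes.
  - assert (K := definable_rename (scons 0 (fun i => S (S i))) H).
    assert (K1 := definable_rename (scons 0 (fun i => S (S (S i)))) H).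
    simpl in K, K1.
    unfold describes, unique. definability.
Qed.

Definition setof (P : V -> Prop) : V := the (fun c => forall x, x ∈ c <-> P x).

Lemma in_setof P x : is_set P -> x ∈ setof P <-> P x.
Proof.
  intros [c Hc]. unfold setof.
  replace (the _) with c; [apply Hc|]. symmetry. apply the_eq; [exact Hc|].
  intros z Hz. apply ext. intro y. rewrite Hz, Hc. tauto.
Qed.

Lemma definable_setof (P : (nat -> V) -> V -> Prop) :
  definable (fun e => P (fun i => e (S i)) (e 0)) ->
  definable_term (fun e => setof (P e)).
Proof.
  intro H. assert (K := definable_rename (scons 0 (fun i => S (S i))) H). simpl in K.
  apply (definable_the (P := fun e c => forall x, x ∈ c <-> P e x)). definability.
Qed.
End Descriptions.

Ltac definability_of_term ::=
  first [simple apply definable_setof | simple apply definable_the].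

(** * Pairs, products and functions *)

Section Sets.
Context {V : structure} {HV : ZF V}.
Implicit Types (a b c d f x y z n : V).

Definition empty : V := setof (fun _ => False).

Lemma in_empty x : ~ x ∈ empty.
Proof.
  unfold empty. rewrite in_setof; [tauto|].
  destruct exists_empty as [z Hz]. exists z. intro y. split; [apply Hz|tauto].
Qed.

Lemma is_empty_eq z : is_empty z -> z = empty.
Proof. intro H. apply ext. intro x. split; intro K; [destruct (H x K)|destruct (in_empty K)]. Qed.

Definition upair a b : V := setof (fun x => x = a \/ x = b).

Lemma in_upair a b x : x ∈ upair a b <-> x = a \/ x = b.
Proof. apply (in_setof (P := fun y => y = a \/ y = b)), (zf_pairing HV). Qed.

#[global] Instance definable_upair : definable_fun2 upair.
Proof. unfold_definable; unfold upair. definability. Qed.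

Lemma upair_inj a b c d : upair a b = upair c d -> (a = c /\ b = d) \/ (a = d /\ b = c).
Proof.
  intro H.
  assert (K : forall x, x = a \/ x = b <-> x = c \/ x = d)
    by (intro x; rewrite <- !in_upair, H; tauto).
  assert (K1 := proj1 (K a) (or_introl eq_refl)).
  assert (K2 := proj1 (K b) (or_intror eq_refl)).
  assert (K3 := proj2 (K c) (or_introl eq_refl)).
  assert (K4 := proj2 (K d) (or_intror eq_refl)).
  destruct K1, K2, K3, K4; subst; auto.
Qed.

Definition opair a b : V := upair (upair a a) (upair a b).

#[global] Instance definable_opair : definable_fun2 opair.
Proof. unfold_definable; unfold opair. definability. Qed.

Lemma opair_inj a b c d : opair a b = opair c d -> a = c /\ b = d.
Proof.
  intro H. apply upair_inj in H. destruct H as [[H1 H2]|[H1 H2]];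
    apply upair_inj in H1; apply upair_inj in H2; intuition congruence.
Qed.

Lemma is_upair_eq p a b : is_upair p a b <-> p = upair a b.
Proof.
  split.
  - intro H. apply ext. intro x. rewrite in_upair. apply H.
  - intros -> x. apply in_upair.
Qed.

Lemma is_opair_eq p a b : is_opair p a b <-> p = opair a b.
Proof.
  split.
  - intros (s & d & H1 & H2 & H3). apply is_upair_eq in H1, H2, H3. now subst.
  - intros ->. exists (upair a a), (upair a b). now rewrite !is_upair_eq.
Qed.

Lemma rel_opair f x y : rel f x y <-> opair x y ∈ f.
Proof.
  split.
  - intros (p & H & K). apply is_opair_eq in H. now subst.
  - intro H. exists (opair x y). now rewrite is_opair_eq.
Qed.

Lemma is_set_or (P Q : V -> Prop) : is_set P -> is_set Q -> is_set (fun x => P x \/ Q x).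
Proof.
  intros [a Ha] [b Hb]. destruct (is_set_union (upair a b)) as [c Hc]. exists c. intro x.
  rewrite Hc, <- Ha, <- Hb. split.
  - intros (y & H & K). apply in_upair in H. destruct H; subst; auto.
  - intros [H|H]; [exists a|exists b]; rewrite in_upair; auto.
Qed.

Lemma is_set_in a : is_set (fun x => x ∈ a).
Proof. exists a. tauto. Qed.

Lemma is_set_eq a : is_set (fun x => x = a).
Proof. exists (upair a a). intro x. rewrite in_upair. tauto. Qed.

Definition union a b : V := setof (fun x => x ∈ a \/ x ∈ b).

Lemma in_union a b x : x ∈ union a b <-> x ∈ a \/ x ∈ b.
Proof. apply (in_setof (P := fun y => y ∈ a \/ y ∈ b)), is_set_or; apply is_set_in. Qed.

#[global] Instance definable_union : definable_fun2 union.
Proof. unfold_definable; unfold union. definability. Qed.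

Definition adjoin a x : V := setof (fun y => y ∈ a \/ y = x).

Lemma in_adjoin a x y : y ∈ adjoin a x <-> y ∈ a \/ y = x.
Proof. apply (in_setof (P := fun y => y ∈ a \/ y = x)), is_set_or; [apply is_set_in|apply is_set_eq]. Qed.

#[global] Instance definable_adjoin : definable_fun2 adjoin.
Proof. unfold_definable; unfold adjoin. definability. Qed.

Definition sep a (P : V -> Prop) : V := setof (fun x => x ∈ a /\ P x).

Lemma in_sep a P x : definable1 P -> x ∈ sep a P <-> x ∈ a /\ P x.
Proof. intro H. apply (in_setof (P := fun y => y ∈ a /\ P y)), is_set_sep, H. Qed.

Definition image (F : V -> V) a : V := setof (fun y => exists x, x ∈ a /\ y = F x).

Lemma in_image F a y : definable_fun1 F -> y ∈ image F a <-> exists x, x ∈ a /\ y = F x.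
Proof. intro H. apply (in_setof (P := fun y => exists x, x ∈ a /\ y = F x)), is_set_image, H. Qed.

Lemma is_set_powerset a : is_set (fun x => subset x a).
Proof. apply (zf_powerset HV). Qed.

Definition bigunion a : V := setof (fun x => exists y, y ∈ a /\ x ∈ y).

Lemma in_bigunion a x : x ∈ bigunion a <-> exists y, y ∈ a /\ x ∈ y.
Proof. apply (in_setof (P := fun x => exists y, y ∈ a /\ x ∈ y)), is_set_union. Qed.

Definition product a b : V :=
  bigunion (image (fun x => image (opair x) b) a).

Lemma in_product a b p : p ∈ product a b <-> exists x y, x ∈ a /\ y ∈ b /\ p = opair x y.
Proof.
  assert (H : forall x, definable_fun1 (opair x)) by (intro; unfold_definable; definability).
  assert (K : definable_fun1 (fun x => image (opair x) b))
    by (unfold_definable; unfold image; definability).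
  unfold product. rewrite in_bigunion. split.
  - intros (y & H1 & H2). apply in_image in H1; [|assumption]. destruct H1 as (x & H1 & ->).
    apply in_image in H2; [|auto]. destruct H2 as (y & H2 & ->). eauto.
  - intros (x & y & H1 & H2 & ->). exists (image (opair x) b). split; apply in_image; eauto.
Qed.

Definition app f x : V := the (fun y => rel f x y).

#[global] Instance definable_app : definable_fun2 app.
Proof. unfold_definable; unfold app. definability. Qed.

Lemma rel_is_fun f a b x y : is_fun f a b -> rel f x y -> x ∈ a /\ y ∈ b /\ app f x = y.
Proof.
  intros [H1 H2] H. assert (K := H). apply rel_opair in K. apply H1 in K.
  destruct K as (x' & y' & Hx & Hy & E). apply is_opair_eq in E. apply opair_inj in E.
  destruct E as [<- <-]. repeat split; auto. apply the_eq; auto. intros z Hz.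
  destruct (H2 x Hx) as (w & _ & K). rewrite <- (K y H). symmetry. now apply K.
Qed.

Lemma rel_app f a b x : is_fun f a b -> x ∈ a -> rel f x (app f x).
Proof.
  intros H Hx. destruct (proj2 H x Hx) as (y & K & _).
  destruct (rel_is_fun H K) as (_ & _ & E). congruence.
Qed.

Lemma app_in f a b x : is_fun f a b -> x ∈ a -> app f x ∈ b.
Proof. intros H Hx. apply (rel_is_fun H (rel_app H Hx)). Qed.

Lemma rel_iff_app f a b x y : is_fun f a b -> x ∈ a -> rel f x y <-> app f x = y.
Proof.
  intros H Hx. split.
  - intro K. apply (rel_is_fun H K).
  - intros <-. eapply rel_app; eauto.
Qed.

Lemma fun_ext f g a b c : is_fun f a b -> is_fun g a c ->
  (forall x, x ∈ a -> app f x = app g x) -> f = g.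
Proof.
  intros Hf Hg H. apply ext.
  enough (K : forall f g b c, is_fun f a b -> is_fun g a c ->
    (forall x, x ∈ a -> app f x = app g x) -> forall p, p ∈ f -> p ∈ g).
  { intro p. split; [eapply K|eapply K]; eauto. intros; symmetry; auto. }
  clear. intros f g b c Hf Hg H p Hp. assert (K := Hp). apply Hf in K.
  destruct K as (x & y & Hx & Hy & E). apply is_opair_eq in E. subst p.
  apply rel_opair. apply rel_opair in Hp. rewrite (rel_iff_app y Hg Hx), <- H by assumption.
  eapply rel_iff_app; eauto.
Qed.

Definition lambda a (F : V -> V) : V := image (fun x => opair x (F x)) a.

Lemma rel_lambda a F x y : definable_fun1 F ->
  rel (lambda a F) x y <-> x ∈ a /\ y = F x.
Proof.
  intro H. rewrite rel_opair. unfold lambda. rewrite in_image by (unfold_definable; definability).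
  split.
  - intros (z & Hz & E). apply opair_inj in E. now destruct E as [-> ->].
  - intros [H1 ->]. eauto.
Qed.

Lemma lambda_is_fun a b F : definable_fun1 F -> (forall x, x ∈ a -> F x ∈ b) ->
  is_fun (lambda a F) a b.
Proof.
  intros H K. split.
  - intros p Hp. apply in_image in Hp; [|unfold_definable; definability].
    destruct Hp as (x & Hx & ->). exists x, (F x). rewrite is_opair_eq. auto.
  - intros x Hx. exists (F x). split; [now apply rel_lambda|].
    intros y Hy. apply rel_lambda in Hy; [|assumption]. now destruct Hy as [_ ->].
Qed.

Lemma app_lambda a F x : definable_fun1 F -> x ∈ a -> app (lambda a F) x = F x.
Proof.
  intros H Hx. apply the_eq; [now apply rel_lambda|].
  intros z Hz. now apply rel_lambda in Hz.
Qed.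

Lemma is_set_tuples a n : is_set (is_tuple a n).
Proof.
  destruct (is_set_powerset (product n a)) as [c Hc].
  apply (is_set_subclass (a := c)).
  - unfold_definable; definability.
  - intros x Hx. apply Hc. intros p Hp. apply Hx in Hp.
    destruct Hp as (i & y & H1 & H2 & E). apply is_opair_eq in E. subst p.
    apply in_product; eauto.
Qed.

(** * Natural numbers and finite sets *)

Definition succ n : V := adjoin n n.

Lemma in_succ n x : x ∈ succ n <-> x ∈ n \/ x = n.
Proof. apply in_adjoin. Qed.

#[global] Instance definable_succ : definable_fun1 succ.
Proof. unfold_definable; unfold succ. definability. Qed.

Lemma is_succ_eq n m : is_succ m n <-> m = succ n.
Proof.
  split.
  - intro H. apply ext. intro x. rewrite in_succ. apply H.
  - intros -> x. apply in_succ.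
Qed.

Lemma inductive_iff w :
  inductive w <-> empty ∈ w /\ forall x, x ∈ w -> succ x ∈ w.
Proof.
  split.
  - intros [(z & H1 & H2) H]. apply is_empty_eq in H1. subst z. split; [assumption|].
    intros x Hx. destruct (H x Hx) as (y & E & Hy). apply is_succ_eq in E. now subst.
  - intros [H1 H2]. split.
    + exists empty. split; [intro; apply in_empty|assumption].
    + intros x Hx. exists (succ x). rewrite is_succ_eq. auto.
Qed.

Lemma is_nat_empty : is_nat empty.
Proof. intros w H. now apply inductive_iff in H. Qed.

Lemma is_nat_succ n : is_nat n -> is_nat (succ n).
Proof. intros H w Hw. assert (K := H w Hw). apply inductive_iff in Hw. now apply Hw. Qed.

Lemma nat_induction (P : V -> Prop) : definable1 P ->
  P empty -> (forall n, is_nat n -> P n -> P (succ n)) -> forall n, is_nat n -> P n.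
Proof.
  intros D H0 HS n Hn. destruct (zf_infinity HV) as [w Hw].
  assert (D' : definable1 (fun x => is_nat x /\ P x)).
  { unfold_definable. definability. }
  assert (K : n ∈ sep w (fun x => is_nat x /\ P x)).
  { apply Hn. apply inductive_iff. apply inductive_iff in Hw. destruct Hw as [Hw1 Hw2].
    rewrite in_sep by assumption. split.
    - auto using is_nat_empty.
    - intros x Hx. rewrite in_sep in * by assumption.
      destruct Hx as (H1 & H2 & H3). auto using is_nat_succ. }
  apply in_sep in K; tauto.
Qed.

Lemma not_in_self x : ~ x ∈ x.
Proof.
  intro H. destruct (zf_foundation HV (a := upair x x)) as (y & H1 & H2).
  - exists x. apply in_upair; auto.
  - apply in_upair in H1. assert (y = x) by tauto. subst y.
    apply (H2 x); [apply in_upair; auto|assumption].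
Qed.

(** Finiteness in the sense of Kuratowski: membership in every family that
    contains ∅ and is closed under adding an element of [a].  It is equivalent to
    having an enumeration by a natural number, but gives induction and closure
    under unions, products and images with no arithmetic. *)
Definition finite a : Prop :=
  forall F, empty ∈ F -> (forall t x, t ∈ F -> x ∈ a -> adjoin t x ∈ F) -> a ∈ F.

#[global] Instance definable_finite : definable1 finite.
Proof. unfold_definable; unfold finite. definability. Qed.

Lemma finite_empty : finite empty.
Proof. intros F H _. exact H. Qed.

Lemma finite_adjoin a x : finite a -> finite (adjoin a x).
Proof.
  intros H F H0 HS. apply HS; [|rewrite in_adjoin; auto].
  apply H; auto. intros t y Ht Hy. apply HS; auto. rewrite in_adjoin; auto.
Qed.

Lemma finite_induction (P : V -> Prop) a : definable1 P -> P empty ->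
  (forall t x, finite t -> subset t a -> x ∈ a -> P t -> P (adjoin t x)) ->
  finite a -> P a.
Proof.
  intros D H0 HS Ha. destruct (is_set_powerset a) as [c Hc].
  assert (D' : definable1 (fun x => finite x /\ P x)) by (unfold_definable; definability).
  assert (K : a ∈ sep c (fun x => finite x /\ P x)).
  { apply Ha.
    - rewrite in_sep, Hc by assumption. repeat split; auto using finite_empty.
      intros x Hx. destruct (in_empty Hx).
    - intros t x Ht Hx. rewrite in_sep, Hc in * by assumption.
      destruct Ht as (H1 & H2 & H3). repeat split; auto using finite_adjoin.
      intros y Hy. apply in_adjoin in Hy. destruct Hy; subst; auto. }
  apply in_sep in K; tauto.
Qed.

Lemma union_empty a : union a empty = a.
Proof.
  apply ext. intro x. rewrite in_union. split; [|auto]. intros [H|H]; auto. destruct (in_empty H).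
Qed.

Lemma finite_union a b : finite a -> finite b -> finite (union a b).
Proof.
  intro Ha. apply (finite_induction (P := fun t => finite (union a t))).
  - unfold_definable; definability.
  - now rewrite union_empty.
  - intros t x _ _ _ H. replace (union a (adjoin t x)) with (adjoin (union a t) x).
    + now apply finite_adjoin.
    + apply ext. intro y. rewrite in_adjoin, !in_union, in_adjoin. tauto.
Qed.

Lemma finite_image F a : definable_fun1 F -> finite a -> finite (image F a).
Proof.
  intro D. apply (finite_induction (P := fun t => finite (image F t))).
  - unfold_definable; unfold image; definability.
  - replace (image F empty) with empty; [apply finite_empty|].
    apply ext. intro x. rewrite in_image by assumption.
    split; [intro H; destruct (in_empty H)|intros (y & H & _); destruct (in_empty H)].
  - intros t x _ _ _ H. replace (image F (adjoin t x)) with (adjoin (image F t) (F x)).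
    + now apply finite_adjoin.
    + apply ext. intro y. rewrite in_adjoin, !in_image by assumption. split.
      * intros [(z & Hz & ->)| ->]; [exists z|exists x]; rewrite in_adjoin; auto.
      * intros (z & Hz & ->). apply in_adjoin in Hz. destruct Hz as [Hz| ->]; eauto.
Qed.

#[global] Instance definable_opair_l x : definable_fun1 (opair x).
Proof. unfold_definable; definability. Qed.

Lemma finite_product a b : finite a -> finite b -> finite (product a b).
Proof.
  intros Ha Hb. revert Ha. apply (finite_induction (P := fun t => finite (product t b))).
  - unfold_definable; unfold product, bigunion, image; definability.
  - replace (product empty b) with empty; [apply finite_empty|].
    apply ext. intro x. rewrite in_product.
    split; [intro H; destruct (in_empty H)|intros (y & z & H & _); destruct (in_empty H)].
  - intros t x _ _ _ H.
    replace (product (adjoin t x) b) with (union (product t b) (image (opair x) b)).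
    + apply finite_union; auto. apply finite_image; auto. typeclasses eauto.
    + apply ext. intro p. rewrite in_union, !in_product, in_image by typeclasses eauto. split.
      * intros [(y & z & H1 & H2 & ->)|(z & H1 & ->)].
        -- exists y, z. rewrite in_adjoin; auto.
        -- exists x, z. rewrite in_adjoin; auto.
      * intros (y & z & H1 & H2 & ->). apply in_adjoin in H1.
        destruct H1 as [H1| ->]; [left|right]; eauto.
Qed.

Lemma finite_nat n : is_nat n -> finite n.
Proof.
  apply nat_induction.
  - apply definable_finite.
  - apply finite_empty.
  - intros m _. apply finite_adjoin.
Qed.

Lemma adjoin_in a x : x ∈ a -> adjoin a x = a.
Proof. intro H. apply ext. intro y. rewrite in_adjoin. split; [intros [K| ->]|]; auto. Qed.

Lemma finite_sep a P : definable1 P -> finite a -> finite (sep a P).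
Proof.
  intro D. apply (finite_induction (P := fun t => finite (sep t P))).
  - unfold_definable; unfold sep; definability.
  - replace (sep empty P) with empty; [apply finite_empty|].
    apply ext. intro x. rewrite in_sep by assumption.
    split; [intro H; destruct (in_empty H)|intros [H _]; destruct (in_empty H)].
  - intros t x _ _ _ H. destruct (classic (P x)) as [Hx|Hx].
    + replace (sep (adjoin t x) P) with (adjoin (sep t P) x); [now apply finite_adjoin|].
      apply ext. intro y. rewrite in_adjoin, !in_sep, in_adjoin by assumption.
      split; [intros [K| ->]|]; tauto.
    + replace (sep (adjoin t x) P) with (sep t P); [assumption|].
      apply ext. intro y. rewrite !in_sep, in_adjoin by assumption.
      split; [tauto|]. intros [[K| ->] K']; tauto.
Qed.

Lemma is_bijection_adjoin n f a x : is_bijection f n a -> ~ x ∈ a ->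
  is_bijection (adjoin f (opair n x)) (succ n) (adjoin a x).
Proof.
  intros [Hf Hb] Hx.
  assert (R : forall u v, rel (adjoin f (opair n x)) u v <-> rel f u v \/ (u = n /\ v = x)).
  { intros u v. rewrite !rel_opair, in_adjoin. split; intros [H|H]; auto.
    - apply opair_inj in H. auto.
    - destruct H; subst; auto. }
  split; [split|].
  - intros p Hp. apply in_adjoin in Hp. destruct Hp as [Hp| ->].
    + apply Hf in Hp. destruct Hp as (u & v & H1 & H2 & H3). exists u, v.
      rewrite in_succ, in_adjoin. auto.
    + exists n, x. rewrite in_succ, in_adjoin, is_opair_eq. auto.
  - intros u Hu. apply in_succ in Hu. destruct Hu as [Hu| ->].
    + exists (app f u). split.
      * apply R. left. eapply rel_app; eauto.
      * intros v Hv. apply R in Hv. destruct Hv as [Hv|[-> _]].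
        -- apply (rel_is_fun Hf Hv).
        -- destruct (not_in_self Hu).
    + exists x. split; [apply R; auto|]. intros v Hv. apply R in Hv.
      destruct Hv as [Hv|[_ ->]]; auto.
      apply (rel_is_fun Hf) in Hv. destruct (not_in_self (proj1 Hv)).
  - intros v Hv. apply in_adjoin in Hv. destruct Hv as [Hv| ->].
    + destruct (Hb v Hv) as (u & H1 & H2). exists u. split; [apply R; auto|].
      intros u' Hu. apply R in Hu. destruct Hu as [Hu|[_ ->]]; auto. tauto.
    + exists n. split; [apply R; auto|]. intros u Hu. apply R in Hu.
      destruct Hu as [Hu|[-> _]]; auto. apply (rel_is_fun Hf) in Hu. tauto.
Qed.

(** The link with enumerations: it makes an [infinite] set not [finite]. *)
Lemma finite_bijection a : finite a -> exists n f, is_nat n /\ is_bijection f n a.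
Proof.
  apply (finite_induction (P := fun a => exists n f, is_nat n /\ is_bijection f n a)).
  - unfold_definable; definability.
  - exists empty, empty. split; [apply is_nat_empty|].
    split; [split|]; intros x Hx; destruct (in_empty Hx).
  - intros t x _ _ _ (n & f & Hn & Hf). destruct (classic (x ∈ t)) as [K|K].
    + rewrite adjoin_in by assumption. eauto.
    + exists (succ n), (adjoin f (opair n x)). auto using is_nat_succ, is_bijection_adjoin.
Qed.

(** Fresh elements are what the infinity of the amorphous set contributes to
    completeness: there are always further atoms, outside any finite support. *)
Lemma infinite_fresh a b : infinite a -> finite b -> exists x, x ∈ a /\ ~ x ∈ b.
Proof.
  intros Ha Hb. apply NNPP. intro H. apply Ha. apply finite_bijection.
  replace a with (sep b (fun x => x ∈ a)).
  - apply finite_sep; auto. unfold_definable; definability.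
  - apply ext. intro x. rewrite in_sep by (unfold_definable; definability).
    split; [tauto|]. intro K. split; auto. apply NNPP. eauto.
Qed.
End Sets.

(** * Relations on a strongly amorphous set are finitely supported *)

#[global] Instance definable_app_l {V : structure} {HV : ZF V} (f : V) : definable_fun1 (app f).
Proof. unfold_definable; definability. Qed.

Section Swap.
Context {V : structure} {HV : ZF V}.
Implicit Types (a b i n x y z A R S : V).

Definition swap a b x : V :=
  the (fun y => (x = a /\ y = b) \/ (x <> a /\ x = b /\ y = a) \/ (x <> a /\ x <> b /\ y = x)).

Lemma swap_l a b : swap a b a = b.
Proof. apply the_eq; [tauto|]. intros z; tauto. Qed.

Lemma swap_r a b : swap a b b = a.
Proof.
  destruct (classic (b = a)) as [->|H]; [apply swap_l|].
  apply the_eq; [tauto|]. intros z; tauto.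
Qed.

Lemma swap_other a b x : x <> a -> x <> b -> swap a b x = x.
Proof. intros H K. apply the_eq; [tauto|]. intros z; tauto. Qed.

Lemma swap_cases a b x :
  (x = a /\ swap a b x = b) \/ (x <> a /\ x = b /\ swap a b x = a) \/
  (x <> a /\ x <> b /\ swap a b x = x).
Proof.
  destruct (classic (x = a)) as [->|H]; [left; split; auto using swap_l|].
  destruct (classic (x = b)) as [->|K]; [right; left; auto using swap_r|].
  right; right; auto using swap_other.
Qed.

Lemma swap_inj a b x y : swap a b x = swap a b y -> x = y.
Proof.
  intro H. destruct (swap_cases a b x) as [[-> K]|[(K0 & -> & K)|(K0 & K1 & K)]],
    (swap_cases a b y) as [[-> L]|[(L0 & -> & L)|(L0 & L1 & L)]]; congruence.
Qed.

Lemma swap_in A a b x : a ∈ A -> b ∈ A -> x ∈ A -> swap a b x ∈ A.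
Proof.
  intros. destruct (swap_cases a b x) as [[-> K]|[(K0 & -> & K)|(K0 & K1 & K)]]; congruence.
Qed.

Definition act a b n x : V := lambda n (fun i => swap a b (app x i)).

#[global] Instance definable_swap_app a b x : definable_fun1 (fun i => swap a b (app x i)).
Proof. unfold_definable; unfold swap. definability. Qed.

Lemma act_tuple A a b n x : a ∈ A -> b ∈ A -> is_tuple A n x -> is_tuple A n (act a b n x).
Proof.
  intros Ha Hb Hx. apply lambda_is_fun; [typeclasses eauto|].
  intros i Hi. apply swap_in; auto. eapply app_in; eauto.
Qed.

Lemma app_act a b n x i : i ∈ n -> app (act a b n x) i = swap a b (app x i).
Proof. intro Hi. apply (app_lambda (F := fun i => swap a b (app x i))); auto. typeclasses eauto. Qed.

(** The parameters that define [R] lie in [S].  Transpositions that fix [S]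
    pointwise stand for the full stabilizer of [S]; they suffice below, and
    there is no formula syntax to handle inside the model. *)
Definition supported A n S R : Prop :=
  forall a b, a ∈ A -> b ∈ A -> ~ a ∈ S -> ~ b ∈ S ->
  forall x, is_tuple A n x -> x ∈ R <-> act a b n x ∈ R.

Instance definable_supported A n : definable2 (supported A n).
Proof. unfold_definable; unfold supported, act, lambda, image, swap. definability. Qed.

(** The supported relations form a Boolean algebra: the supports of two relations
    may be united.  An equality of two entries is supported by ∅, and an equality
    with the parameter [c] by {c}. *)
Lemma strongly_amorphous_supported A n R :
  strongly_amorphous A -> is_nat n -> is_relation A n R ->
  exists S, finite S /\ subset S A /\ supported A n S R.
Proof.
  intros HA Hn HR.
  destruct (is_set_tuples A n) as [P HP].
  set (Q := fun R => exists S, finite S /\ subset S A /\ supported A n S R).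
  assert (DQ : definable1 Q) by (unfold Q; unfold_definable; definability).
  destruct (is_set_powerset P) as [PP HPP].
  destruct (is_set_sep PP DQ) as [B HB].
  assert (HB' : forall R, R ∈ B <-> is_relation A n R /\ Q R).
  { intro T. rewrite HB, HPP. unfold is_relation, subset.
    split; intros [H1 H2]; split; auto; intros x Hx; apply HP; auto. }
  enough (K : R ∈ B) by (apply HB' in K; apply K).
  apply (HA n R Hn HR); [split; [|split; [|split]]|split].
  - intros T HT. now apply HB'.
  - intros T HT. apply HB'. split; [intros x Hx; now apply HT|].
    exists empty. split; [apply finite_empty|split].
    + intros x Hx. destruct (in_empty Hx).
    + intros a b Ha Hb _ _ x Hx. split; intro; apply HT; auto using act_tuple.
  - intros T U HT HU. apply HB' in HT. destruct HT as (HT & S & HS1 & HS2 & HS3).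
    apply HB'. split; [intros x Hx; now apply HU in Hx|]. exists S. split; [|split]; auto.
    intros a b Ha Hb Ha' Hb' x Hx. rewrite !HU, (HS3 a b) by assumption.
    split; intros [_ H]; split; auto using act_tuple.
  - intros T T' U HT HT' HU. apply HB' in HT, HT'.
    destruct HT as (HT & S & HS1 & HS2 & HS3).
    destruct HT' as (HT' & S' & HS1' & HS2' & HS3').
    apply HB'. split; [intros x Hx; apply HU in Hx; destruct Hx; auto|].
    exists (union S S'). split; [now apply finite_union|split].
    + intros x Hx. apply in_union in Hx. destruct Hx; auto.
    + intros a b Ha Hb Ha' Hb' x Hx. rewrite in_union in Ha', Hb'.
      rewrite !HU, (HS3 a b), (HS3' a b) by tauto. tauto.
  - intros i j D Hi Hj HD. apply HB'. split; [intros x Hx; now apply HD in Hx|].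
    exists empty. split; [apply finite_empty|split].
    + intros x Hx. destruct (in_empty Hx).
    + assert (K : forall x, is_tuple A n x -> (x ∈ D <-> app x i = app x j)).
      { intros x Hx. rewrite HD. split.
        - intros (_ & a & H1 & H2). apply (rel_is_fun Hx) in H1, H2. intuition congruence.
        - intro H. split; auto. exists (app x i). split; [|rewrite H]; eapply rel_app; eauto. }
      intros a b Ha Hb _ _ x Hx. rewrite !K, !app_act by auto using act_tuple.
      split; [congruence|apply swap_inj].
  - intros i c D Hi Hc HD. apply HB'. split; [intros x Hx; now apply HD in Hx|].
    exists (adjoin empty c). split; [apply finite_adjoin, finite_empty|split].
    + intros x Hx. apply in_adjoin in Hx. destruct Hx as [Hx| ->]; auto. destruct (in_empty Hx).
    + assert (K : forall x, is_tuple A n x -> (x ∈ D <-> app x i = c)).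
      { intros x Hx. rewrite HD, (rel_iff_app _ Hx Hi). tauto. }
      intros a b Ha Hb Ha' Hb' x Hx. rewrite in_adjoin in Ha', Hb'.
      rewrite !K, !app_act by auto using act_tuple.
      rewrite <- (swap_other (a := a) (b := b) (x := c)) at 2 by (intro; subst; tauto).
      split; [congruence|apply swap_inj].
Qed.

Definition snoc n x y : V :=
  lambda (succ n) (fun i => the (fun z => (i ∈ n /\ z = app x i) \/ (~ i ∈ n /\ z = y))).

Lemma app_snoc n x y i : i ∈ n -> app (snoc n x y) i = app x i.
Proof.
  intro Hi. unfold snoc. rewrite app_lambda.
  - apply the_eq; [tauto|]. intro z; tauto.
  - unfold_definable. definability.
  - apply in_succ; auto.
Qed.

Lemma app_snoc_last n x y : app (snoc n x y) n = y.
Proof.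
  assert (K := @not_in_self V HV n).
  unfold snoc. rewrite app_lambda.
  - apply the_eq; [tauto|]. intro z; tauto.
  - unfold_definable. definability.
  - apply in_succ; auto.
Qed.

Lemma snoc_tuple A n x y : is_tuple A n x -> y ∈ A -> is_tuple A (succ n) (snoc n x y).
Proof.
  intros Hx Hy. apply lambda_is_fun; [unfold_definable; definability|].
  intros i Hi. destruct (classic (i ∈ n)) as [K|K].
  - rewrite the_eq with (y := app x i); [eapply app_in; eauto|tauto|]. intro z; tauto.
  - rewrite the_eq with (y := y); [assumption|tauto|]. intro z; tauto.
Qed.

Lemma tuple_ext A n x y : is_tuple A n x -> is_tuple A n y ->
  (forall i, i ∈ n -> app x i = app y i) -> x = y.
Proof. apply fun_ext. Qed.

Definition init n z : V := lambda n (app z).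

Lemma init_tuple A n z : is_tuple A (succ n) z -> is_tuple A n (init n z).
Proof.
  intro H. apply (lambda_is_fun (F := app z)); [typeclasses eauto|].
  intros i Hi. eapply app_in; [apply H|]. apply in_succ; auto.
Qed.

Lemma app_init n z i : i ∈ n -> app (init n z) i = app z i.
Proof. apply (app_lambda (F := app z)). typeclasses eauto. Qed.

(** Support of the graph of [f], read as a relation of arity n + 1: if (x, f(x))
    is moved by a transposition, the result is still on the graph. *)
Lemma strongly_amorphous_equivariant A n P f :
  strongly_amorphous A -> is_nat n -> is_power P A n -> is_fun f P A ->
  exists S, finite S /\ subset S A /\
  forall a b, a ∈ A -> b ∈ A -> ~ a ∈ S -> ~ b ∈ S ->
  forall x, is_tuple A n x -> app f (act a b n x) = swap a b (app f x).
Proof.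
  intros HA Hn HP Hf.
  destruct (is_set_tuples A (succ n)) as [P' HP'].
  assert (D : definable1 (fun z => app f (init n z) = app z n))
    by (unfold_definable; unfold init, lambda, image; definability).
  set (R := sep P' (fun z => app f (init n z) = app z n)).
  assert (HR : forall z, z ∈ R <-> is_tuple A (succ n) z /\ app f (init n z) = app z n).
  { intro z. unfold R. rewrite in_sep, HP' by assumption. tauto. }
  destruct (@strongly_amorphous_supported A (succ n) R HA) as (S & HS1 & HS2 & HS3).
  - now apply is_nat_succ.
  - intros z Hz. now apply HR in Hz.
  - exists S. split; [|split]; auto. intros a b Ha Hb Ha' Hb' x Hx.
    assert (Hfx : app f x ∈ A) by (eapply app_in; [apply Hf|]; now apply HP).
    set (z := snoc n x (app f x)).
    assert (Hz : is_tuple A (succ n) z) by now apply snoc_tuple.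
    assert (E : init n z = x).
    { apply (tuple_ext (A := A) (n := n)); auto using init_tuple.
      intros i Hi. unfold z. now rewrite app_init, app_snoc. }
    assert (K : z ∈ R).
    { apply HR. split; auto. unfold z at 2. now rewrite E, app_snoc_last. }
    apply (HS3 a b Ha Hb Ha' Hb' z Hz) in K. apply HR in K. destruct K as [K1 K].
    rewrite app_act in K by (apply in_succ; auto). unfold z at 2 in K.
    rewrite app_snoc_last in K. rewrite <- K. f_equal.
    apply (tuple_ext (A := A) (n := n)); auto using init_tuple, act_tuple.
    intros i Hi. rewrite app_init, !app_act by (try apply in_succ; auto).
    unfold z. now rewrite app_snoc.
Qed.

(** Otherwise a transposition of f(x) with a fresh element would fix [x] but move
    f(x). *)
Lemma equivariant_value A n P f S x : infinite A -> is_nat n -> is_power P A n -> is_fun f P A ->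
  finite S ->
  (forall a b, a ∈ A -> b ∈ A -> ~ a ∈ S -> ~ b ∈ S ->
    forall x, is_tuple A n x -> app f (act a b n x) = swap a b (app f x)) ->
  is_tuple A n x -> ~ app f x ∈ S -> exists i, i ∈ n /\ app f x = app x i.
Proof.
  intros HA Hn HP Hf HS K Hx HfS. apply NNPP. intro H.
  assert (Hfx : app f x ∈ A) by (eapply app_in; [apply Hf|]; now apply HP).
  destruct (infinite_fresh (b := adjoin (union S (image (app x) n)) (app f x)) HA) as (b & Hb & Hb').
  { apply finite_adjoin, finite_union; auto. apply finite_image, finite_nat; auto.
    typeclasses eauto. }
  rewrite in_adjoin, in_union, in_image in Hb' by typeclasses eauto.
  assert (E : act (app f x) b n x = x).
  { apply (tuple_ext (A := A) (n := n)); auto using act_tuple.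
    intros i Hi. rewrite app_act by assumption. apply swap_other; intro E; [apply H|apply Hb']; eauto. }
  assert (L := K (app f x) b Hfx Hb HfS ltac:(tauto) x Hx).
  rewrite E, swap_l in L. auto.
Qed.
End Swap.

(** * The lattice of height two on an infinite set *)

Section Lattice.
Context {V : structure} {HV : ZF V}.
Variables (A o l : V).
Hypotheses (Ho : o ∈ A) (Hl : l ∈ A) (Hol : o <> l).
Implicit Types (a b i n x y z : V).

(** As [o] and [l] are taken from the set itself, the lattice is again strongly
    amorphous, and no tuples over a larger set have to be coded. *)
Definition le x y : Prop := x = y \/ x = o \/ y = l.

Definition order : V :=
  sep (product A A) (fun p => exists x y, p = opair x y /\ le x y).

Lemma rel_order x y : rel order x y <-> x ∈ A /\ y ∈ A /\ le x y.
Proof.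
  rewrite rel_opair. unfold order.
  rewrite in_sep by (unfold_definable; unfold le; definability).
  rewrite in_product. split.
  - intros [(x1 & y1 & H1 & H2 & E1) (x2 & y2 & E2 & H)].
    apply opair_inj in E1, E2. destruct E1, E2; subst. auto.
  - intros (H1 & H2 & H3). split; eauto.
Qed.

Lemma le_refl x : le x x.
Proof. unfold le; auto. Qed.

Lemma le_trans x y z : le x y -> le y z -> le x z.
Proof. unfold le. intuition congruence. Qed.

Lemma le_antisym x y : le x y -> le y x -> x = y.
Proof. unfold le. intuition congruence. Qed.

Lemma le_bot x : le o x.
Proof. unfold le; auto. Qed.

Lemma le_top x : le x l.
Proof. unfold le; auto. Qed.

Definition join x y : V :=
  if excluded_middle_informative (le x y) then y
  else if excluded_middle_informative (le y x) then x else l.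

Definition meet x y : V :=
  if excluded_middle_informative (le x y) then x
  else if excluded_middle_informative (le y x) then y else o.

Lemma join_spec x y :
  le x (join x y) /\ le y (join x y) /\ forall z, le x z -> le y z -> le (join x y) z.
Proof.
  unfold join. destruct (excluded_middle_informative (le x y)) as [H|H];
    [|destruct (excluded_middle_informative (le y x)) as [K|K]];
    repeat split; auto using le_refl, le_top.
  unfold le in *. intros z H1 H2. intuition congruence.
Qed.

Lemma meet_spec x y :
  le (meet x y) x /\ le (meet x y) y /\ forall z, le z x -> le z y -> le z (meet x y).
Proof.
  unfold meet. destruct (excluded_middle_informative (le x y)) as [H|H];
    [|destruct (excluded_middle_informative (le y x)) as [K|K]];
    repeat split; auto using le_refl, le_bot.
  unfold le in *. intros z H1 H2. intuition congruence.
Qed.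

Lemma join_in x y : x ∈ A -> y ∈ A -> join x y ∈ A.
Proof. unfold join. intros. destruct excluded_middle_informative; [|destruct excluded_middle_informative]; auto. Qed.

Lemma meet_in x y : x ∈ A -> y ∈ A -> meet x y ∈ A.
Proof. unfold meet. intros. destruct excluded_middle_informative; [|destruct excluded_middle_informative]; auto. Qed.

Lemma is_join_join x y : x ∈ A -> y ∈ A -> is_join A order x y (join x y).
Proof.
  intros Hx Hy. destruct (join_spec x y) as (H1 & H2 & H3). unfold is_join.
  rewrite !rel_order. repeat split; auto using join_in.
  intros u _. rewrite !rel_order. intuition auto using join_in.
Qed.

Lemma is_meet_meet x y : x ∈ A -> y ∈ A -> is_meet A order x y (meet x y).
Proof.
  intros Hx Hy. destruct (meet_spec x y) as (H1 & H2 & H3). unfold is_meet.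
  rewrite !rel_order. repeat split; auto using meet_in.
  intros u _. rewrite !rel_order. intuition auto using meet_in.
Qed.

Lemma is_lattice_order : is_lattice A order.
Proof.
  split; [split; [|split; [|split]]|].
  - intros p Hp. apply in_sep in Hp; [|unfold_definable; unfold le; definability].
    destruct Hp as [Hp _]. apply in_product in Hp. destruct Hp as (x & y & H1 & H2 & ->).
    exists x, y. now rewrite is_opair_eq.
  - intros x Hx. apply rel_order. auto using le_refl.
  - intros x y H K. apply rel_order in H, K. apply le_antisym; tauto.
  - intros x y z H K. apply rel_order in H, K. apply rel_order.
    intuition eauto using le_trans.
  - intros x y Hx Hy. split; [exists (join x y)|exists (meet x y)];
      auto using is_join_join, is_meet_meet.
Qed.

(** * Lattice polynomials *)

Lemma exists_tagged k x : exists t, is_tagged k t x.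
Proof.
  assert (H : exists c : V, is_numeral k c).
  { induction k as [|k [c IH]].
    - exists empty. intros y Hy. destruct (in_empty Hy).
    - exists (succ c), c. now rewrite is_succ_eq. }
  destruct H as [c Hc]. exists (opair c x), c. now rewrite is_opair_eq.
Qed.

#[global] Instance definable_is_numeral k : definable1 (@is_numeral V k).
Proof. induction k; unfold definable1 in *; simpl; definability. Qed.
#[global] Instance definable_is_tagged k : definable2 (@is_tagged V k).
Proof. unfold_definable; unfold is_tagged. definability. Qed.
#[global] Instance definable_var_term : definable2 (@var_term V).
Proof. unfold_definable; unfold var_term. definability. Qed.
#[global] Instance definable_const_term : definable2 (@const_term V).
Proof. unfold_definable; unfold const_term. definability. Qed.
#[global] Instance definable_join_term : definable3 (@join_term V).
Proof. unfold_definable; unfold join_term. definability. Qed.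
#[global] Instance definable_meet_term : definable3 (@meet_term V).
Proof. unfold_definable; unfold meet_term. definability. Qed.
#[global] Instance definable_is_polynomial L n : definable1 (@is_polynomial V L n).
Proof. unfold_definable; unfold is_polynomial, closed_under_terms. definability. Qed.
#[global] Instance definable_is_join L r : definable3 (@is_join V L r).
Proof. unfold_definable; unfold is_join. definability. Qed.
#[global] Instance definable_is_meet L r : definable3 (@is_meet V L r).
Proof. unfold_definable; unfold is_meet. definability. Qed.
#[global] Instance definable_has_value L r n : definable3 (@has_value V L r n).
Proof. unfold_definable; unfold has_value, closed_under_evaluation. definability. Qed.

Variable n : V.

(** Some polynomial has at every [x] a value [y] with [Q x y].  Describing values
    by a relation avoids naming the function a polynomial induces, and makes the
    existence of a polynomial a single definable predicate, as internal
    inductions need it. *)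
Definition attainable (Q : V -> V -> Prop) : Prop :=
  exists p, is_polynomial A n p /\
  forall x, is_tuple A n x -> exists y, y ∈ A /\ has_value A order n x p y /\ Q x y.

Lemma attainable_mono (Q Q' : V -> V -> Prop) :
  (forall x y, is_tuple A n x -> y ∈ A -> Q x y -> Q' x y) -> attainable Q -> attainable Q'.
Proof.
  intros H (p & Hp & K). exists p. split; auto. intros x Hx.
  destruct (K x Hx) as (y & H1 & H2 & H3). eauto.
Qed.

Lemma attainable_const a : a ∈ A -> attainable (fun _ y => y = a).
Proof.
  intro Ha. destruct (exists_tagged 1 a) as [t Ht]. exists t. split.
  - intros T HT. destruct HT as (_ & H & _). eauto.
  - intros x Hx. exists a. split; [|split]; auto.
    intros W (_ & H & _). eauto.
Qed.

Lemma attainable_var i : i ∈ n -> attainable (fun x y => y = app x i).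
Proof.
  intro Hi. destruct (exists_tagged 0 i) as [t Ht]. exists t. split.
  - intros T HT. destruct HT as (H & _). eauto.
  - intros x Hx. exists (app x i). split; [eapply app_in; eauto|split]; auto.
    intros W (H & _). apply (H i); auto. eapply rel_app; eauto.
Qed.

Lemma attainable_join (Q1 Q2 : V -> V -> Prop) : attainable Q1 -> attainable Q2 ->
  attainable (fun x y => exists y1 y2, y1 ∈ A /\ y2 ∈ A /\ Q1 x y1 /\ Q2 x y2 /\ y = join y1 y2).
Proof.
  intros (p & Hp & K) (q & Hq & K'). destruct (exists_tagged 2 (opair p q)) as [t Ht].
  assert (Ht' : join_term t p q) by (exists (opair p q); now rewrite is_opair_eq).
  exists t. split.
  - intros T HT. assert (H := HT). destruct H as (_ & _ & H & _). apply (H p q); auto.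
  - intros x Hx. destruct (K x Hx) as (y & H1 & H2 & H3).
    destruct (K' x Hx) as (y' & H1' & H2' & H3').
    exists (join y y'). split; [auto using join_in|split; [|exists y, y'; auto]].
    intros W HW. assert (H := HW). destruct H as (_ & _ & H & _).
    apply (H p q t y y'); auto using is_join_join.
Qed.

Lemma attainable_meet (Q1 Q2 : V -> V -> Prop) : attainable Q1 -> attainable Q2 ->
  attainable (fun x y => exists y1 y2, y1 ∈ A /\ y2 ∈ A /\ Q1 x y1 /\ Q2 x y2 /\ y = meet y1 y2).
Proof.
  intros (p & Hp & K) (q & Hq & K'). destruct (exists_tagged 3 (opair p q)) as [t Ht].
  assert (Ht' : meet_term t p q) by (exists (opair p q); now rewrite is_opair_eq).
  exists t. split.
  - intros T HT. assert (H := HT). destruct H as (_ & _ & _ & H). apply (H p q); auto.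
  - intros x Hx. destruct (K x Hx) as (y & H1 & H2 & H3).
    destruct (K' x Hx) as (y' & H1' & H2' & H3').
    exists (meet y y'). split; [auto using meet_in|split; [|exists y, y'; auto]].
    intros W HW. assert (H := HW). destruct H as (_ & _ & _ & H).
    apply (H p q t y y'); auto using is_meet_meet.
Qed.

Lemma definable_attainable (Q : (nat -> V) -> V -> V -> Prop) :
  definable (fun e => Q (fun k => e (S (S k))) (e 1) (e 0)) ->
  definable (fun e => attainable (Q e)).
Proof.
  intro H. assert (K := definable_rename (scons 0 (scons 1 (fun k => S (S (S k))))) H).
  simpl in K. unfold attainable. definability.
Qed.

(** The meet of a family of polynomials indexed by an internally finite set.
    Each factor contributes an upper bound [Q a] on the value, which survives
    further meets because it is closed downwards, while all factors share the
    property [W], which must itself be closed under meets. *)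
Lemma attainable_meet_family (W : V -> V -> Prop) (Q : V -> V -> V -> Prop) s :
  definable2 W -> definable3 Q -> finite s ->
  (forall x, W x l) ->
  (forall x y y', W x y -> W x y' -> W x (meet y y')) ->
  (forall a x y y', Q a x y -> le y' y -> Q a x y') ->
  (forall a, a ∈ s -> attainable (fun x y => W x y /\ Q a x y)) ->
  attainable (fun x y => W x y /\ forall a, a ∈ s -> Q a x y).
Proof.
  intros DW DQ Hs Wl Wm Qm.
  apply (finite_induction (P := fun s => (forall a, a ∈ s -> attainable (fun x y => W x y /\ Q a x y)) ->
    attainable (fun x y => W x y /\ forall a, a ∈ s -> Q a x y))); auto.
  - unfold_definable. apply definable_imp.
    + unfold attainable. definability.
    + apply (definable_attainable (Q := fun e x y => W x y /\ forall a, a ∈ e 0 -> Q a x y)).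
      definability.
  - intros _. apply attainable_mono with (2 := attainable_const Hl).
    intros x y _ _ ->. split; auto. intros a Ha. destruct (in_empty Ha).
  - intros t b _ _ _ IH H.
    assert (H1 : attainable (fun x y => W x y /\ Q b x y)) by (apply H, in_adjoin; auto).
    assert (H2 : attainable (fun x y => W x y /\ forall a, a ∈ t -> Q a x y)).
    { apply IH. intros a Ha. apply H, in_adjoin; auto. }
    apply attainable_mono with (2 := attainable_meet H1 H2).
    intros x y _ _ (y1 & y2 & _ & _ & [K1 K2] & [K3 K4] & ->).
    destruct (meet_spec y1 y2) as (M1 & M2 & _). split; auto.
    intros a Ha. apply in_adjoin in Ha. destruct Ha as [Ha| ->]; eauto.
Qed.

(** Here [G] is an operation of the metatheory, so that single tests are written
    as ordinary expressions in [join] and [meet]. *)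
Definition polynomial_fun (G : V -> V) : Prop := attainable (fun x y => y = G x).

Lemma polynomial_fun_const a : a ∈ A -> polynomial_fun (fun _ => a).
Proof. intro Ha. exact (attainable_const Ha). Qed.

Lemma polynomial_fun_app i : i ∈ n -> polynomial_fun (fun x => app x i).
Proof. intro Hi. exact (attainable_var Hi). Qed.

Lemma polynomial_fun_join G H : polynomial_fun G -> polynomial_fun H ->
  polynomial_fun (fun x => join (G x) (H x)).
Proof.
  intros K1 K2. apply attainable_mono with (2 := attainable_join K1 K2).
  intros x y _ _ (y1 & y2 & _ & _ & -> & -> & ->). reflexivity.
Qed.

Lemma polynomial_fun_meet G H : polynomial_fun G -> polynomial_fun H ->
  polynomial_fun (fun x => meet (G x) (H x)).
Proof.
  intros K1 K2. apply attainable_mono with (2 := attainable_meet K1 K2).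
  intros x y _ _ (y1 & y2 & _ & _ & -> & -> & ->). reflexivity.
Qed.

Definition atom a : Prop := a ∈ A /\ a <> o /\ a <> l.

(** For distinct atoms a, b, c this maps the elements above [a] to [l] and all
    others to [o]: meeting with [a] leaves [a] or [o]; then joining with [b] and
    meeting with [c] turns [a] into [c] and keeps [o]; finally a ∨ c = l. *)
Definition above a b c x : V := join (meet x a) (meet (join (meet x a) b) c).

Ltac lattice_cases :=
  repeat match goal with
  | |- context [excluded_middle_informative ?P] => destruct (excluded_middle_informative P)
  end; unfold le in *.

Lemma meet_atom_above a x : le a x -> meet x a = a.
Proof.
  intro H. destruct (meet_spec x a) as (H1 & H2 & H3). apply le_antisym; auto using le_refl.
Qed.

Lemma meet_atom_not_above a x : atom a -> ~ le a x -> meet x a = o.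
Proof.
  intros (_ & H & H') K. destruct (meet_spec x a) as (H1 & H2 & _). 
  unfold le in H2. destruct H2 as [E|[E|E]]; auto; [|congruence].
  rewrite E in H1. contradiction.
Qed.

Lemma join_atoms a b : atom a -> atom b -> a <> b -> join a b = l.
Proof. unfold atom. intros. unfold join. lattice_cases; intuition congruence. Qed.

Lemma meet_atoms a b : atom a -> atom b -> a <> b -> meet a b = o.
Proof. unfold atom. intros. unfold meet. lattice_cases; intuition congruence. Qed.

Lemma join_bot x : join o x = x.
Proof. unfold join. lattice_cases; intuition congruence. Qed.

Lemma meet_top x : meet l x = x.
Proof. unfold meet. lattice_cases; intuition congruence. Qed.

Lemma above_true a b c x : atom a -> atom b -> atom c -> a <> b -> a <> c -> b <> c -> le a x ->
  above a b c x = l.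
Proof.
  intros. unfold above. rewrite meet_atom_above by assumption.
  rewrite (join_atoms (a := a) (b := b)) by assumption. rewrite meet_top. now apply join_atoms.
Qed.

Lemma above_false a b c x : atom a -> atom b -> atom c -> b <> c -> ~ le a x ->
  above a b c x = o.
Proof.
  intros. unfold above. rewrite meet_atom_not_above by assumption.
  rewrite !join_bot. now apply meet_atoms.
Qed.

Lemma polynomial_above a b c G : atom a -> atom b -> atom c ->
  polynomial_fun G -> polynomial_fun (fun x => above a b c (G x)).
Proof.
  intros (Ha & _) (Hb & _) (Hc & _) HG. unfold above.
  repeat (apply polynomial_fun_join || apply polynomial_fun_meet); auto;
    now apply polynomial_fun_const.
Qed.

Hypothesis HA : infinite A.

Lemma fresh_atom s : finite s -> exists a, atom a /\ ~ a ∈ s.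
Proof.
  intro H. destruct (infinite_fresh (b := adjoin (adjoin s o) l) HA) as (a & H1 & H2).
  - now apply finite_adjoin, finite_adjoin.
  - rewrite !in_adjoin in H2. exists a. unfold atom. intuition.
Qed.

Lemma fresh_atoms a : exists b c, atom b /\ atom c /\ a <> b /\ a <> c /\ b <> c.
Proof.
  destruct (fresh_atom (s := adjoin empty a)) as (b & Hb & Kb).
  { apply finite_adjoin, finite_empty. }
  destruct (fresh_atom (s := adjoin (adjoin empty a) b)) as (c & Hc & Kc).
  { apply finite_adjoin, finite_adjoin, finite_empty. }
  rewrite !in_adjoin in *. exists b, c. intuition congruence.
Qed.

(** The characteristic function of the elements above [a] is polynomial.  For the
    top, this is the meet of the functions [above] for two atoms, since only [l]
    lies above both. *)
Lemma attainable_above a G : a ∈ A -> polynomial_fun G ->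
  attainable (fun x y => (le a (G x) -> y = l) /\ (~ le a (G x) -> y = o)).
Proof.
  intros Ha HG.
  destruct (classic (a = o)) as [->|Hao].
  { apply attainable_mono with (2 := attainable_const Hl). intros x y _ _ ->.
    split; auto. intro H. destruct H. apply le_bot. }
  destruct (classic (a = l)) as [->|Hal].
  - destruct (fresh_atoms o) as (b & c & Hb & Hc & _ & _ & Hbc).
    destruct (fresh_atom (s := adjoin (adjoin empty b) c)) as (d & Hd & Hd').
    { apply finite_adjoin, finite_adjoin, finite_empty. }
    rewrite !in_adjoin in Hd'.
    apply attainable_mono with (2 := attainable_meet
      (polynomial_above Hb Hc Hd HG) (polynomial_above Hc Hb Hd HG)).
    intros x y _ _ (y1 & y2 & _ & _ & -> & -> & ->).
    split; intro H.
    + rewrite !above_true; auto; try (intuition congruence).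
      * apply meet_top.
      * destruct Hb as (_ & _ & ?). unfold le in *. intuition congruence.
      * destruct Hc as (_ & _ & ?). unfold le in *. intuition congruence.
    + destruct (classic (le b (G x))) as [K|K].
      * rewrite above_true, (@above_false c); try (intuition congruence).
        -- apply meet_top.
        -- unfold atom, le in *. intuition congruence.
      * rewrite above_false; try (intuition congruence).
        apply le_antisym; [apply meet_spec|apply le_bot].
  - destruct (fresh_atoms a) as (b & c & Hb & Hc & Hab & Hac & Hbc).
    assert (Ha' : atom a) by (unfold atom; auto).
    apply attainable_mono with (2 := polynomial_above Ha' Hb Hc HG).
    intros x y _ _ ->. split; intro; auto using above_true, above_false.
Qed.
End Lattice.

(** * Tuples below a given tuple *)

#[global] Instance definable_le {V : structure} (o l : V) : definable2 (le o l).
Proof. unfold_definable; unfold le. definability. Qed.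

Section Completeness.
Context {V : structure} {HV : ZF V}.
Variables (A o l t n P f S : V).
Hypotheses (HA : infinite A) (Ho : o ∈ A) (Hl : l ∈ A) (Hol : o <> l).
Hypotheses (Hn : is_nat n) (HP : is_power P A n) (Hf : is_fun f P A).
Hypotheses (HS : finite S) (HSA : subset S A) (HoS : o ∈ S) (HlS : l ∈ S)
  (HtS : t ∈ S) (Hto : t <> o) (Htl : t <> l).
Hypothesis equivariant : forall a b, a ∈ A -> b ∈ A -> ~ a ∈ S -> ~ b ∈ S ->
  forall x, is_tuple A n x -> app f (act a b n x) = swap a b (app f x).
Hypothesis monotone : forall x x', is_tuple A n x -> is_tuple A n x' ->
  (forall i, i ∈ n -> le o l (app x i) (app x' i)) -> le o l (app f x) (app f x').
Notation "x <= y" := (le o l x y).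
Notation tuple := (is_tuple A n).
Notation join := (join o l).
Notation meet := (meet o l).
Notation attainable := (attainable A o l n).
Notation polynomial_fun := (polynomial_fun A o l n).
Implicit Types (a b c i j s x y z : V).

Lemma value_cases x : tuple x -> ~ app f x ∈ S -> exists i, i ∈ n /\ app f x = app x i.
Proof. eapply equivariant_value; eauto. Qed.

Lemma entry_in x i : tuple x -> i ∈ n -> app x i ∈ A.
Proof. intros. eapply app_in; eauto. Qed.

(** Recording how the value of [f] arises from the tuple lets the induction that
    decides the equalities between entries decide the value as well. *)
Definition same_type c x : Prop :=
  (forall i j, i ∈ n -> j ∈ n -> app x i = app x j <-> app c i = app c j) /\
  (forall i s, i ∈ n -> s ∈ S -> app x i = s <-> app c i = s) /\
  (forall i, i ∈ n -> app f x = app x i <-> app f c = app c i) /\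
  (forall s, s ∈ S -> app f x = s <-> app f c = s).

Instance definable_same_type c : definable1 (same_type c).
Proof. unfold_definable; unfold same_type. definability. Qed.

Lemma same_type_refl c : same_type c c.
Proof. unfold same_type. repeat split; auto. Qed.

Lemma swap_fixes a b s : s ∈ S -> ~ a ∈ S -> ~ b ∈ S -> swap a b s = s.
Proof. intros. apply swap_other; congruence. Qed.

Lemma swap_eq_fixed a b x s : s ∈ S -> ~ a ∈ S -> ~ b ∈ S -> swap a b x = s <-> x = s.
Proof.
  intros H1 H2 H3. split.
  - intro E. apply (swap_inj (a := a) (b := b)). now rewrite (swap_fixes H1 H2 H3).
  - intros ->. now apply swap_fixes.
Qed.

Lemma swap_eq a b x y : swap a b x = swap a b y <-> x = y.
Proof. split; [apply swap_inj|congruence]. Qed.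

Lemma same_type_act c x a b : a ∈ A -> b ∈ A -> ~ a ∈ S -> ~ b ∈ S -> tuple x ->
  same_type c x -> same_type c (act a b n x).
Proof.
  intros Ha Hb Ha' Hb' Hx (H1 & H2 & H3 & H4).
  split; [|split; [|split]].
  - intros i j Hi Hj. rewrite !app_act, swap_eq by assumption. auto.
  - intros i s Hi Hs. rewrite app_act, swap_eq_fixed by assumption. auto.
  - intros i Hi. rewrite equivariant, app_act, swap_eq by assumption. auto.
  - intros s Hs. rewrite equivariant, swap_eq_fixed by assumption. auto.
Qed.

(** Entries of a tuple outside [S] are atoms.  If [x] lies above a tuple of the
    type of [c], then the entries of [x] over two equal free entries of [c] are
    nonzero and, unless one is [l], equal; over two distinct ones they cannot be
    the same atom.  These pairwise conditions, with those of
    [compatible_parameter], turn out to be sufficient. *)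
Definition compatible c x i j : Prop :=
  ~ app c i ∈ S -> ~ app c j ∈ S ->
  (app c i = app c j -> app x i <> o /\ app x j <> o /\
     (app x i = app x j \/ app x i = l \/ app x j = l)) /\
  (app c i <> app c j -> app x i <> app x j \/ app x i = l \/ app x j = l).

Definition compatible_parameter c x i s : Prop :=
  (app c i = s -> s <= app x i) /\
  (~ app c i ∈ S -> app x i = s -> app x i = l \/ app x i = o).

(** The tuple is found greedily: the coordinates are visited in turn, and if
    c'_k is not yet below x_k, then both are atoms outside [S] and are
    transposed.  This does not spoil an earlier coordinate i.  If c'_i = c'_k,
    compatibility makes x_i equal to x_k or [l]; if c'_i = x_k, it forces
    x_i = l. *)
Lemma exists_below c x : tuple c -> tuple x ->
  (forall i j, i ∈ n -> j ∈ n -> compatible c x i j) ->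
  (forall i s, i ∈ n -> s ∈ S -> compatible_parameter c x i s) ->
  exists c', tuple c' /\ same_type c c' /\ forall i, i ∈ n -> app c' i <= app x i.
Proof.
  intros Hc Hx H1 H2.
  enough (K : forall k, is_nat k -> subset k n ->
    exists c', tuple c' /\ same_type c c' /\ forall i, i ∈ k -> app c' i <= app x i).
  { apply (K n Hn). intros y Hy; exact Hy. }
  apply (nat_induction (P := fun k => subset k n ->
    exists c', tuple c' /\ same_type c c' /\ forall i, i ∈ k -> app c' i <= app x i)).
  - unfold_definable. unfold subset, same_type. definability.
  - intros _. exists c. split; [|split]; auto using same_type_refl.
    intros i Hi. destruct (in_empty Hi).
  - intros k Hk IH Hkn. destruct IH as (c' & Hc' & Ht & Hle).
    { intros y Hy. apply Hkn, in_succ; auto. }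
    assert (Hkn' : k ∈ n) by (apply Hkn, in_succ; auto).
    assert (Hin : forall i, i ∈ k -> i ∈ n) by (intros; apply Hkn, in_succ; auto).
    destruct (classic (app c' k <= app x k)) as [Hck|Hck].
    { exists c'. split; [|split]; auto. intros i Hi. apply in_succ in Hi.
      destruct Hi as [Hi| ->]; auto. }
    assert (T := Ht). destruct T as (T1 & T2 & T3 & T4).
    assert (Hxl : app x k <> l) by (intro E; apply Hck; rewrite E; apply le_top).
    assert (HcS : forall i, i ∈ n -> (app c' i ∈ S <-> app c i ∈ S)).
    { intros i Hi. split; intro K.
      - rewrite (proj1 (T2 i _ Hi K) eq_refl). assumption.
      - rewrite (proj2 (T2 i _ Hi K) eq_refl). assumption. }
    assert (Hck' : ~ app c k ∈ S).
    { intro K. apply Hck. rewrite (proj2 (T2 k _ Hkn' K) eq_refl).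
      destruct (H2 k _ Hkn' K) as [G _]. auto. }
    assert (Hxo : app x k <> o) by (apply (H1 k k Hkn' Hkn' Hck' Hck'); auto).
    assert (HxS : ~ app x k ∈ S).
    { intro K. destruct (H2 k _ Hkn' K) as [_ G]. destruct (G Hck'); auto. }
    assert (HcS' : ~ app c' k ∈ S) by (rewrite HcS; auto).
    exists (act (app c' k) (app x k) n c').
    split; [|split].
    + apply act_tuple; auto using entry_in.
    + apply same_type_act; auto using entry_in.
    + intros i Hi. apply in_succ in Hi. destruct Hi as [Hi| ->].
      2:{ rewrite app_act, swap_l by assumption. apply le_refl. }
      rewrite app_act by auto. assert (Hi' := Hin i Hi). assert (L := Hle i Hi).
      destruct (swap_cases (app c' k) (app x k) (app c' i))
        as [[E ->]|[(E0 & E & ->)|(E0 & E1 & ->)]]; auto.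
      * assert (E' : app c i = app c k) by (apply T1; auto).
        destruct (H1 i k Hi' Hkn') as [G _]; auto; [congruence|].
        destruct (G E') as (_ & _ & [G'|[G'|G']]); [rewrite G'; apply le_refl| |contradiction].
        rewrite G'. apply le_top.
      * assert (E' : app c i <> app c k) by (rewrite <- T1 by auto; auto).
        assert (HiS : ~ app c i ∈ S) by (rewrite <- HcS, E by assumption; auto).
        destruct (H1 i k Hi' Hkn' HiS Hck') as [_ G].
        destruct (G E') as [G'|[G'|G']]; [|rewrite G'; apply le_top|contradiction].
        rewrite E in L. destruct L as [L|[L|L]]; [congruence|contradiction|].
        rewrite L. apply le_top.
Qed.

(** Let c' ≤ x be of the type of [c].  If f(c) is in [S], then f(c') = f(c).
    Otherwise f(c') is an entry of [c'], over a block of coordinates where [c] is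
    constant.  If some x_j over this block is not [l], it equals f(c'), and [y]
    is bounded by x_j.  If all of them are [l], the value of [c'] on the block
    may be replaced by a fresh atom, so f(x) is above two atoms. *)
Lemma le_value c x y : tuple c -> tuple x ->
  (forall i j, i ∈ n -> j ∈ n -> compatible c x i j) ->
  (forall i s, i ∈ n -> s ∈ S -> compatible_parameter c x i s) ->
  (forall i, i ∈ n -> app c i = app f c -> y <= app x i) ->
  (forall s, s ∈ S -> app f c = s -> y <= s) ->
  y <= app f x.
Proof.
  intros Hc Hx H1 H2 H3 H4.
  destruct (exists_below Hc Hx H1 H2) as (c' & Hc' & T & Hle).
  assert (T' := T). destruct T' as (T1 & T2 & T3 & T4).
  assert (M := monotone Hc' Hx Hle).
  destruct (classic (app f c ∈ S)) as [K|K].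
  { apply (le_trans Hol) with (app f c); auto.
    now rewrite (proj2 (T4 _ K) eq_refl) in M. }
  destruct (value_cases Hc K) as (i & Hi & E).
  assert (E' : app f c' = app c' i) by now apply T3.
  assert (HcS : ~ app c i ∈ S) by congruence.
  assert (HcS' : ~ app c' i ∈ S).
  { intro G. apply HcS. now rewrite (proj1 (T2 i _ Hi G) eq_refl). }
  destruct (classic (exists j, j ∈ n /\ app c j = app c i /\ app x j <> l)) as [(j & Hj & Ej & Hxj)|N].
  - apply (le_trans Hol) with (app x j); [apply H3; congruence|].
    assert (L := Hle j Hj).
    rewrite (proj2 (T1 j i Hj Hi) Ej) in L.
    rewrite E' in M. destruct L as [L|[L|L]]; [congruence| |contradiction].
    exfalso. apply HcS'. congruence.
  - destruct (infinite_fresh (b := union S (image (app c') n)) HA) as (b & Hb & Hb').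
    { apply finite_union; auto. apply finite_image, finite_nat; auto. typeclasses eauto. }
    rewrite in_union, in_image in Hb' by typeclasses eauto.
    assert (Hi' := entry_in Hc' Hi).
    assert (M' : app f (act (app c' i) b n c') <= app f x).
    { apply monotone; auto using act_tuple. intros j Hj. rewrite app_act by assumption.
      destruct (swap_cases (app c' i) b (app c' j))
        as [[G ->]|[(G0 & G & ->)|(G0 & G1 & ->)]]; auto.
      - replace (app x j) with l; [apply le_top|]. apply NNPP. intro N'. apply N.
        exists j. split; [|split]; auto. apply T1; auto.
      - exfalso. apply Hb'. right. exists j; auto. }
    rewrite equivariant, E', swap_l in M' by tauto.
    rewrite E' in M. unfold le in M, M'.
    assert (b <> app c' i) by (intro; apply Hb'; eauto).
    assert (b <> o) by (intro; subst; tauto).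
    assert (app c' i <> o) by congruence.
    replace (app f x) with l; [apply le_top|]. intuition congruence.
Qed.

(** * The polynomial of a type *)

(** What every factor of the polynomial built for [c] satisfies; meets preserve
    it, and it makes the polynomial at least [f] on the type of [c]. *)
Definition dominates c x y : Prop := same_type c x -> app f x <= y.

Instance definable_dominates c : definable2 (dominates c).
Proof. unfold_definable; unfold dominates. definability. Qed.

Lemma dominates_top c x : dominates c x l.
Proof. intros _. apply le_top. Qed.

Lemma dominates_meet c x y y' : dominates c x y -> dominates c x y' -> dominates c x (meet y y').
Proof. intros H K T. apply meet_spec; auto. Qed.

(** A polynomial that is [l] where a ≤ G(x) and [o] elsewhere is a factor that
    enforces [C], provided that the test succeeds on the type of [c]. *)
Lemma attainable_test c a G (C : V -> Prop) : a ∈ A -> polynomial_fun G ->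
  (forall x, tuple x -> same_type c x -> a <= G x) ->
  (forall x, tuple x -> a <= G x -> C x) ->
  attainable (fun x y => dominates c x y /\ (y = o \/ C x)).
Proof.
  intros Ha HG H1 H2.
  assert (K := attainable_above Ho Hl Hol HA Ha HG).
  apply attainable_mono with (2 := K). intros x y Hx _ [K1 K2].
  destruct (classic (a <= G x)) as [L|L].
  - rewrite (K1 L). auto using dominates_top.
  - rewrite (K2 L). split; auto. intro T. destruct L; auto.
Qed.

Lemma attainable_trivial c (C : V -> V -> Prop) : (forall x, tuple x -> C x l) ->
  attainable (fun x y => dominates c x y /\ C x y).
Proof.
  intro H. apply attainable_mono with (2 := attainable_const o l n Hl).
  intros x y Hx _ ->. auto using dominates_top.
Qed.

Lemma free_atom x i : tuple x -> i ∈ n -> ~ app x i ∈ S -> atom A o l (app x i).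
Proof. intros Hx Hi H. split; [|split]; [now apply entry_in|congruence|congruence]. Qed.

Lemma top_le y : l <= y -> y = l.
Proof. unfold le. intuition congruence. Qed.

Lemma same_type_free c x i : same_type c x -> i ∈ n -> ~ app c i ∈ S -> ~ app x i ∈ S.
Proof. intros (_ & T & _) Hi H K. apply H. now rewrite (proj1 (T i _ Hi K) eq_refl). Qed.

(** For equal free entries the test is (x_i ∧ x_j) ∨ t = l, where [t] is an atom
    in [S]; it fails exactly if the meet is [o] or [t], whereas on the type of
    [c] the meet is an entry outside [S].  For distinct free entries it is
    x_i ∨ x_j = l. *)
Lemma attainable_compatible c i j : i ∈ n -> j ∈ n ->
  attainable (fun x y => dominates c x y /\ (y = o \/ compatible c x i j)).
Proof.
  intros Hi Hj.
  destruct (classic (app c i ∈ S \/ app c j ∈ S)) as [K|K].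
  { apply attainable_trivial. intros x Hx. right. unfold compatible. tauto. }
  assert (Ki : ~ app c i ∈ S) by tauto. assert (Kj : ~ app c j ∈ S) by tauto. clear K.
  assert (Ha : atom A o l t) by (split; auto).
  destruct (classic (app c i = app c j)) as [E|E].
  - apply (attainable_test (a := l) (G := fun x => join (meet (app x i) (app x j)) t)); auto.
    + apply polynomial_fun_join; auto; [apply polynomial_fun_meet; auto|];
        auto using polynomial_fun_app, polynomial_fun_const.
    + intros x Hx T. assert (Fi := same_type_free T Hi Ki).
      assert (E' : app x i = app x j) by exact (proj2 (proj1 T i j Hi Hj) E).
      rewrite <- E', (meet_atom_above Hol (le_refl o l (app x i))).
      rewrite (join_atoms (A := A)); auto using le_refl, free_atom. congruence.
    + intros x Hx L _ _. split; [intros _|tauto]. apply top_le in L.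
      assert (M : meet (app x i) (app x j) <> o).
      { intro M. rewrite M, (join_bot Hol) in L. contradiction. }
      destruct (meet_spec o l (app x i) (app x j)) as (M1 & M2 & _).
      assert (app x i <> o) by (intro G; rewrite G in M1; unfold le in M1; intuition congruence).
      assert (app x j <> o) by (intro G; rewrite G in M2; unfold le in M2; intuition congruence).
      split; [|split]; auto. unfold le in *. intuition congruence.
  - apply (attainable_test (a := l) (G := fun x => join (app x i) (app x j))); auto.
    + apply polynomial_fun_join; auto using polynomial_fun_app.
    + intros x Hx T. rewrite (join_atoms (A := A)).
      * apply le_refl.
      * apply free_atom; eauto using same_type_free.
      * apply free_atom; eauto using same_type_free.
      * intro G. exact (E (proj1 (proj1 T i j Hi Hj) G)).
    + intros x Hx L _ _. split; [tauto|intros _]. apply top_le in L.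
      destruct (classic (app x i = app x j)) as [G|G]; auto.
      right; left. rewrite <- G in L. rewrite <- L.
      apply (le_antisym Hol); [apply join_spec|].
      apply join_spec; apply le_refl.
Qed.

(** An entry equal to [s] is tested by s ≤ x_i.  A free entry is tested by
    x_i ∨ s = l for the atoms [s], which excludes x_i = s. *)
Lemma attainable_compatible_parameter c i s : i ∈ n -> s ∈ S ->
  attainable (fun x y => dominates c x y /\ (y = o \/ compatible_parameter c x i s)).
Proof.
  intros Hi Hs. destruct (classic (app c i ∈ S)) as [K|K].
  - destruct (classic (app c i = s)) as [E|E].
    + apply (attainable_test (a := s) (G := fun x => app x i)); auto using polynomial_fun_app.
      * intros x Hx T. destruct T as (_ & T & _).
        rewrite (proj2 (T i s Hi Hs) E). apply le_refl.
      * intros x Hx L. split; auto. intros; contradiction.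
    + apply attainable_trivial. intros x Hx. right. split; intros; contradiction.
  - destruct (classic (s = o \/ s = l)) as [E|E].
    + apply attainable_trivial. intros x Hx. right. split; [congruence|].
      intros _ ->. tauto.
    + assert (Ha : atom A o l s) by (split; [auto|tauto]).
      apply (attainable_test (a := l) (G := fun x => join (app x i) s)); auto.
      * apply polynomial_fun_join; auto using polynomial_fun_app, polynomial_fun_const.
      * intros x Hx T. assert (F := same_type_free T Hi K).
        rewrite (join_atoms (A := A)); auto using le_refl, free_atom. congruence.
      * intros x Hx L. split; [congruence|]. intros _ G. apply top_le in L. left.
        rewrite G in *. rewrite <- L.
        apply (le_antisym Hol); [apply join_spec|].
        apply join_spec; apply le_refl.
Qed.

Definition approximable (X : V -> Prop) : Prop :=
  attainable (fun x y => y <= app f x /\ (X x -> app f x <= y)).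

Lemma attainable_and c (Q Q' : V -> V -> Prop) :
  attainable (fun x y => dominates c x y /\ Q x y) ->
  attainable (fun x y => dominates c x y /\ Q' x y) ->
  attainable (fun x y => dominates c x y /\
    (exists z, y <= z /\ Q x z) /\ (exists z, y <= z /\ Q' x z)).
Proof.
  intros H H'. apply attainable_mono with (2 := attainable_meet Ho H H').
  intros x y _ _ (y1 & y2 & _ & _ & [K1 K2] & [K3 K4] & ->).
  destruct (meet_spec o l y1 y2) as (M1 & M2 & _).
  split; [|split]; eauto using dominates_meet.
Qed.

Lemma le_bot_eq y : y <= o -> y = o.
Proof. unfold le. intuition congruence. Qed.

(** The meet of all tests and of the value part.  Only one of the two last
    families is nontrivial, unless f(c) is both an entry of [c] and in [S]. *)
Lemma approximable_same_type c : tuple c -> approximable (same_type c).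
Proof.
  intro Hc.
  assert (B : forall y y' (C : Prop), y = o \/ C -> y' <= y -> y' = o \/ C).
  { intros y y' C [->|H] L; auto using le_bot_eq. }
  assert (F1 : attainable (fun x y => dominates c x y /\ forall p, p ∈ product n n ->
    y = o \/ forall i j, p = opair i j -> compatible c x i j)).
  { apply attainable_meet_family with
      (Q := fun p x y => y = o \/ forall i j, p = opair i j -> compatible c x i j); auto.
    - typeclasses eauto.
    - unfold_definable; unfold compatible. definability.
    - apply finite_product; now apply finite_nat.
    - apply dominates_top.
    - apply dominates_meet.
    - intros p x y y'. apply B.
    - intros p Hp. apply in_product in Hp. destruct Hp as (i & j & Hi & Hj & ->).
      apply attainable_mono with (2 := attainable_compatible c Hi Hj).
      intros x y _ _ [D [E|E]]; split; auto. right. intros i' j' G.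
      apply opair_inj in G. now destruct G as [<- <-]. }
  assert (F2 : attainable (fun x y => dominates c x y /\ forall p, p ∈ product n S ->
    y = o \/ forall i s, p = opair i s -> compatible_parameter c x i s)).
  { apply attainable_meet_family with
      (Q := fun p x y => y = o \/ forall i s, p = opair i s -> compatible_parameter c x i s); auto.
    - typeclasses eauto.
    - unfold_definable; unfold compatible_parameter. definability.
    - apply finite_product; auto; now apply finite_nat.
    - apply dominates_top.
    - apply dominates_meet.
    - intros p x y y'. apply B.
    - intros p Hp. apply in_product in Hp. destruct Hp as (i & j & Hi & Hj & ->).
      apply attainable_mono with (2 := attainable_compatible_parameter c Hi Hj).
      intros x y _ _ [D [E|E]]; split; auto. right. intros i' j' G.
      apply opair_inj in G. now destruct G as [<- <-]. }
  assert (F3 : attainable (fun x y => dominates c x y /\ forall i, i ∈ n ->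
    app c i = app f c -> y <= app x i)).
  { apply attainable_meet_family with (Q := fun i x y => app c i = app f c -> y <= app x i); auto.
    - typeclasses eauto.
    - unfold_definable. definability.
    - now apply finite_nat.
    - apply dominates_top.
    - apply dominates_meet.
    - intros i x y y' H L E. eapply le_trans; eauto.
    - intros i Hi. destruct (classic (app c i = app f c)) as [E|E].
      + apply attainable_mono with (2 := attainable_var A o l Hi).
        intros x y Hx _ ->. split; [|intros _; apply le_refl].
        intros (_ & _ & T & _). rewrite (proj2 (T i Hi)) by auto. apply le_refl.
      + apply attainable_trivial. intros; contradiction. }
  assert (F4 : attainable (fun x y => dominates c x y /\ forall s, s ∈ S ->
    app f c = s -> y <= s)).
  { apply attainable_meet_family with (Q := fun s x y => app f c = s -> y <= s); auto.
    - typeclasses eauto.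
    - unfold_definable. definability.
    - apply dominates_top.
    - apply dominates_meet.
    - intros i x y y' H L E. eapply le_trans; eauto.
    - intros s Hs. destruct (classic (app f c = s)) as [E|E].
      + apply attainable_mono with (2 := attainable_const o l n (HSA Hs)).
        intros x y Hx _ ->. split; [|intros _; apply le_refl].
        intros (_ & _ & _ & T). rewrite (proj2 (T s Hs)) by auto. apply le_refl.
      + apply attainable_trivial. intros; contradiction. }
  apply attainable_mono with (2 := attainable_and (attainable_and F1 F2) (attainable_and F3 F4)).
  intros x y Hx _ (D & (u & Lu & (u1 & L1 & K1) & u2 & L2 & K2) &
    (v & Lv & (v1 & L3 & K3) & v2 & L4 & K4)). split; auto.
  destruct (classic (y = o)) as [->|Hy]; [apply le_bot|].
  apply (le_value Hc Hx).
  - intros i j Hi Hj. destruct (K1 (opair i j)) as [E|E]; auto; [apply in_product; eauto|].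
    subst u1. destruct Hy. eauto using le_bot_eq, le_trans.
  - intros i j Hi Hj. destruct (K2 (opair i j)) as [E|E]; auto; [apply in_product; eauto|].
    subst u2. destruct Hy. eauto using le_bot_eq, le_trans.
  - intros i Hi E. eauto using le_trans.
  - intros s Hs E. eauto using le_trans.
Qed.

(** * There are finitely many types *)

Lemma approximable_mono (X Y : V -> Prop) :
  (forall x, tuple x -> X x -> Y x) -> approximable Y -> approximable X.
Proof. intro H. apply attainable_mono. intros x y Hx _ [K1 K2]. auto. Qed.

Lemma approximable_empty (X : V -> Prop) : (forall x, tuple x -> ~ X x) -> approximable X.
Proof.
  intro H. apply attainable_mono with (2 := attainable_const o l n Ho).
  intros x y Hx _ ->. split; [apply le_bot|]. intro K. destruct (H x Hx K).
Qed.

Lemma approximable_union (X Y : V -> Prop) :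
  approximable X -> approximable Y -> approximable (fun x => X x \/ Y x).
Proof.
  intros H K. apply attainable_mono with (2 := attainable_join Hl H K).
  intros x y _ _ (y1 & y2 & _ & _ & [H1 H2] & [K1 K2] & ->).
  destruct (join_spec o l y1 y2) as (J1 & J2 & J3). split; auto.
  intros [G|G]; eauto using le_trans.
Qed.

(** [F] is a family of sets of tuples, regarded as conditions to be decided. *)
Definition agree F c x : Prop := forall X, X ∈ F -> x ∈ X <-> c ∈ X.

(** Induction over [F]: to decide one more condition, take the join of the
    polynomials for its two outcomes.  No list of the types is needed, nor a
    simultaneous choice of polynomials for them. *)
Lemma approximable_split F : finite F ->
  (forall c, tuple c -> approximable (agree F c)) -> approximable (fun _ => True).
Proof.
  apply (finite_induction (P := fun F => (forall c, tuple c -> approximable (agree F c)) ->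
    approximable (fun _ => True))).
  - unfold_definable. unfold approximable, agree. apply definable_imp; [|definability].
    apply definable_all, definable_imp; [definability|].
    apply (definable_attainable A o l n (Q := fun e x y =>
      y <= app f x /\ ((forall X, X ∈ e 1 -> x ∈ X <-> e 0 ∈ X) -> app f x <= y))).
    definability.
  - intro H. destruct (classic (exists c, tuple c)) as [[c Hc]|N].
    + apply approximable_mono with (2 := H c Hc). intros x _ _ X HX. destruct (in_empty HX).
    + apply approximable_empty. eauto.
  - intros T X _ _ _ IH H. apply IH. intros c Hc.
    assert (K : forall Y : Prop, approximable (fun x => agree T c x /\ (x ∈ X <-> Y))).
    { intro Y. destruct (classic (exists c', tuple c' /\ agree T c c' /\ (c' ∈ X <-> Y)))
        as [(c' & Hc' & K1 & K2)|N].
      - apply approximable_mono with (2 := H c' Hc'). intros x _ [G1 G2] Z HZ.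
        apply in_adjoin in HZ. destruct HZ as [HZ| ->]; [|tauto].
        rewrite (G1 Z HZ), (K1 Z HZ). tauto.
      - apply approximable_empty. intros x Hx G. apply N. eauto. }
    apply approximable_mono with (2 := approximable_union (K True) (K False)).
    intros x _ G. destruct (classic (x ∈ X)); tauto.
Qed.

(** These four families of conditions together decide the type. *)
Definition equality_set p : V :=
  sep P (fun x => exists i j, p = opair i j /\ app x i = app x j).
Definition parameter_set p : V :=
  sep P (fun x => exists i s, p = opair i s /\ app x i = s).
Definition projection_set i : V := sep P (fun x => app f x = app x i).
Definition constant_set s : V := sep P (fun x => app f x = s).

Lemma in_equality_set x i j : tuple x ->
  x ∈ equality_set (opair i j) <-> app x i = app x j.
Proof.
  intro Hx. apply HP in Hx. unfold equality_set.
  rewrite in_sep by (unfold_definable; definability). split; [|eauto].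
  intros (_ & i' & j' & E & E'). apply opair_inj in E. now destruct E as [-> ->].
Qed.

Lemma in_parameter_set x i s : tuple x ->
  x ∈ parameter_set (opair i s) <-> app x i = s.
Proof.
  intro Hx. apply HP in Hx. unfold parameter_set.
  rewrite in_sep by (unfold_definable; definability). split; [|eauto].
  intros (_ & i' & j' & E & E'). apply opair_inj in E. now destruct E as [-> ->].
Qed.

Lemma in_projection_set x i : tuple x -> x ∈ projection_set i <-> app f x = app x i.
Proof.
  intro Hx. apply HP in Hx. unfold projection_set.
  rewrite in_sep by (unfold_definable; definability). tauto.
Qed.

Lemma in_constant_set x s : tuple x -> x ∈ constant_set s <-> app f x = s.
Proof.
  intro Hx. apply HP in Hx. unfold constant_set.
  rewrite in_sep by (unfold_definable; definability). tauto.
Qed.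

Lemma approximable_all : approximable (fun _ => True).
Proof.
  assert (D1 : definable_fun1 equality_set)
    by (unfold_definable; unfold equality_set, sep; definability).
  assert (D2 : definable_fun1 parameter_set)
    by (unfold_definable; unfold parameter_set, sep; definability).
  assert (D3 : definable_fun1 projection_set)
    by (unfold_definable; unfold projection_set, sep; definability).
  assert (D4 : definable_fun1 constant_set)
    by (unfold_definable; unfold constant_set, sep; definability).
  apply (@approximable_split (union
    (union (image equality_set (product n n)) (image parameter_set (product n S)))
    (union (image projection_set n) (image constant_set S)))).
  { assert (finite n) by now apply finite_nat.
    repeat apply finite_union; apply finite_image; auto using finite_product. }
  intros c Hc. apply approximable_mono with (2 := approximable_same_type Hc).
  intros x Hx H.
  split; [|split; [|split]].
  - intros i j Hi Hj. rewrite <- !in_equality_set by assumption. apply H.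
    rewrite !in_union. left; left. apply in_image; auto. exists (opair i j).
    split; auto. apply in_product; eauto.
  - intros i s Hi Hs. rewrite <- !in_parameter_set by assumption. apply H.
    rewrite !in_union. left; right. apply in_image; auto. exists (opair i s).
    split; auto. apply in_product; eauto.
  - intros i Hi. rewrite <- !in_projection_set by assumption. apply H.
    rewrite !in_union. right; left. apply in_image; eauto.
  - intros s Hs. rewrite <- !in_constant_set by assumption. apply H.
    rewrite !in_union. right; right. apply in_image; eauto.
Qed.

Lemma monotone_fun_polynomial :
  exists p, is_polynomial A n p /\ induces A (order A o l) n p f.
Proof.
  destruct approximable_all as (p & Hp & K). exists p. split; auto.
  intros x y Hx Hy. destruct (K x Hx) as (z & _ & H2 & H3 & H4).
  apply (rel_is_fun Hf) in Hy. destruct Hy as (_ & _ & <-).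
  now rewrite (le_antisym Hol (H4 I) H3).
Qed.
End Completeness.

Theorem corollary2p4 (V : structure) (HV : ZF V) :
  (exists A : V, infinite A /\ strongly_amorphous A) ->
  exists L r : V,
    is_lattice L r /\ infinite L /\ order_polynomially_complete L r.
Proof.
  intros (A & HA & HA').
  destruct (infinite_fresh HA finite_empty) as (o & Ho & _).
  destruct (infinite_fresh HA (finite_adjoin (x := o) finite_empty)) as (l & Hl & Kl).
  assert (Hol : o <> l) by (intros ->; apply Kl, in_adjoin; auto).
  destruct (fresh_atom o l HA finite_empty) as (t & (Ht & Hto & Htl) & _).
  exists A, (order A o l). split; [now apply is_lattice_order|split; [assumption|]].
  intros n P f Hn HP Hf Hm.
  destruct (strongly_amorphous_equivariant HA' Hn HP Hf) as (S & HS1 & HS2 & HS3).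
  apply (@monotone_fun_polynomial V HV A o l t n P f (adjoin (adjoin (adjoin S o) l) t)); auto.
  - now repeat apply finite_adjoin.
  - intros x Hx. rewrite !in_adjoin in Hx. intuition (subst; auto).
  - rewrite !in_adjoin; auto.
  - rewrite !in_adjoin; auto.
  - rewrite !in_adjoin; auto.
  - intros a b Ha Hb Ha' Hb'. rewrite !in_adjoin in Ha', Hb'. apply HS3; tauto.
  - intros x x' Hx Hx' Hle.
    assert (K : rel (order A o l) (app f x) (app f x')).
    { apply (Hm x x'); auto.
      - intros i a b Hi Ha Hb.
        apply (rel_is_fun Hx) in Ha. apply (rel_is_fun Hx') in Hb.
        destruct Ha as (_ & Ha & <-), Hb as (_ & Hb & <-). apply rel_order; auto.
      - eapply rel_app; [apply Hf|]. now apply HP.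
      - eapply rel_app; [apply Hf|]. now apply HP. }
    apply rel_order in K. tauto.
Qed.
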